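(* Let $G\subset[0,1]^n$ be a compact set of positive Lebesgue measure with empty interior and let $b=\{b_m\}_{m\in\mathbb{N}}\subset(0,1)$ satisfy $\lim_{m\to\infty}b_m=0$. Let $G_m:=(2m,0,\dots,0)+G$ for $m\in\mathbb{N}$, and define the weight $w_{G,b}$ on $\mathbb{R}^n$ as follows: for $y=(y_1,\dots,y_n)$ with $y_1\ge0$, $w_{G,b}(y)=b_m$ if $y\in G_m$ for some $m\in\mathbb{N}$ and $w_{G,b}(y)=1$ if $y\notin\bigcup_mG_m$; for $y_1<0$, $w_{G,b}(y):=w_{G,b}(-y)$. Then the reflection-invariant space $L^1(\mathbb{R}^n,w_{G,b}^{-1})$ does not satisfy the norm fundamental property, and there exists $a\in S(\mathbb{R}^n)$ such that $a\in\mathcal{M}_{L^\infty(\mathbb{R}^n,w_{G,b})}\setminus\mathcal{M}_{L^1(\mathbb{R}^n,w_{G,b}^{-1})}$.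
   Context: For a weight $v$ and $1\le p\le\infty$, $L^p(\mathbb{R}^n,v)$ is the space of measurable $f$ with $\|f\|_{L^p(\mathbb{R}^n,v)}:=\|fv\|_{L^p(\mathbb{R}^n)}<\infty$. For a Banach function space $X$ on $\mathbb{R}^n$ with associate space $X'$ (for $X=L^1(\mathbb{R}^n,w^{-1})$ one has $X'=L^\infty(\mathbb{R}^n,w)$), $X$ has the norm fundamental property if for every $f\in X$, $\|f\|_X=\sup\{|\int f\psi\,dx|: \psi\in C_0^\infty(\mathbb{R}^n),\ \|\psi\|_{X'}\le1\}$. Reflection-invariant means $\|f\|_X=\|f(-\cdot)\|_X$ for all $f\in X$. Fourier transform: $(Fu)(\xi)=\int u(x)e^{-ix\xi}dx$, extended to $S'(\mathbb{R}^n)$. For a normed function space $Z$, $\mathcal{M}_{Z}$ is the set of $a\in S'(\mathbb{R}^n)$ with $\sup\{\|F^{-1}aFu\|_{Z}/\|u\|_{Z}: u\in (S(\mathbb{R}^n)\cap Z)\setminus\{0\}\}<\infty$. *)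

(* Defs.v *)
From HB Require Import structures.
From mathcomp Require Import all_boot all_order all_algebra.
From mathcomp Require Import all_classical all_reals all_analysis.
From mathcomp Require Import complex.

Set Implicit Arguments.
Unset Strict Implicit.
Unset Printing Implicit Defensive.

Import Order.TTheory GRing.Theory Num.Theory.
Import numFieldNormedType.Exports.

Local Open Scope classical_set_scope.
Local Open Scope ring_scope.

Section Rn.
Variable R : realType.

Definition dotRn n (x y : 'rV[R]_n) : R := \sum_(i < n) x 0 i * y 0 i.

Definition borel_set n (A : set 'rV[R]_n) : Prop := <<s open >> A.

Definition borel_fun n (h : 'rV[R]_n -> R) : Prop :=
  forall B : set R, measurable B -> borel_set (h @^-1` B).

Definition borel_cfun n (f : 'rV[R]_n -> R[i]) : Prop :=
  borel_fun (fun x => complex.Re (f x)) /\ borel_fun (fun x => complex.Im (f x)).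

Definition cabs (z : R[i]) : R := Num.sqrt (complex.Re z ^+ 2 + complex.Im z ^+ 2).

(* ---------- Lebesgue integral on R^n ----------
   For nonnegative (extended) functions we use the iterated Lebesgue
   integral over the coordinates (Tonelli); on Borel functions this is the
   integral with respect to the n-dimensional Lebesgue measure. *)
Definition ocons k (t : R) (g : 'I_k -> R) : 'I_k.+1 -> R :=
  fun i => if unlift ord0 i is Some j then g j else t.

Fixpoint iint (k : nat) : (('I_k -> R) -> \bar R) -> \bar R :=
  match k return (('I_k -> R) -> \bar R) -> \bar R with
  | 0 => fun F => F (fun _ => 0)
  | k'.+1 => fun F =>
      (\int[@lebesgue_measure R]_(t in [set: R]) iint (fun g => F (ocons t g)))%E
  end.

Definition Rn_int n (h : 'rV[R]_n -> \bar R) : \bar R :=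
  iint (fun g => h (\row_i g i)).

Definition Rn_meas n (A : set 'rV[R]_n) : \bar R :=
  Rn_int (fun x => (\1_A x)%:E).

Definition Rn_null n (A : set 'rV[R]_n) : Prop :=
  exists N, [/\ borel_set N, A `<=` N & Rn_meas N = 0%E].

Definition Rn_int_real n (h : 'rV[R]_n -> R) : R :=
  fine (Rn_int (fun x => (Num.max (h x) 0)%:E)
        - Rn_int (fun x => (Num.max (- h x) 0)%:E))%E.

Definition Rn_int_c n (f : 'rV[R]_n -> R[i]) : R[i] :=
  Complex (Rn_int_real (fun x => complex.Re (f x))) (Rn_int_real (fun x => complex.Im (f x))).

Definition Rn_esssup n (h : 'rV[R]_n -> R) : \bar R :=
  ereal_inf [set M : \bar R | Rn_null [set x | (M < (h x)%:E)%E]].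

Definition L1w_norm n (v : 'rV[R]_n -> R) (f : 'rV[R]_n -> R[i]) : \bar R :=
  Rn_int (fun x => (cabs (f x) * v x)%:E).

Definition in_L1w n (v : 'rV[R]_n -> R) (f : 'rV[R]_n -> R[i]) : Prop :=
  borel_cfun f /\ (L1w_norm v f < +oo)%E.

Definition Linfw_norm n (v : 'rV[R]_n -> R) (f : 'rV[R]_n -> R[i]) : \bar R :=
  Rn_esssup (fun x => cabs (f x) * v x).

Definition in_Linfw n (v : 'rV[R]_n -> R) (f : 'rV[R]_n -> R[i]) : Prop :=
  borel_cfun f /\ (Linfw_norm v f < +oo)%E.

Definition unitv n (i : 'I_n) : 'rV[R]_n := delta_mx 0 i.

Definition pderiv n (i : 'I_n) (h : 'rV[R]_n -> R) : 'rV[R]_n -> R :=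
  fun x => derive h x (unitv i).

Fixpoint Ck n (k : nat) (h : 'rV[R]_n -> R) : Prop :=
  continuous h /\
  match k with
  | 0 => True
  | k'.+1 => forall i : 'I_n,
      (forall x, derivable h x (unitv i)) /\ Ck k' (pderiv i h)
  end.

Definition smooth_real n (h : 'rV[R]_n -> R) : Prop := forall k, Ck k h.

Definition smooth n (f : 'rV[R]_n -> R[i]) : Prop :=
  smooth_real (fun x => complex.Re (f x)) /\ smooth_real (fun x => complex.Im (f x)).

Definition C0inf n (f : 'rV[R]_n -> R[i]) : Prop :=
  smooth f /\ compact (closure [set x | f x != 0]).

Definition pderivs n (s : seq 'I_n) (h : 'rV[R]_n -> R) : 'rV[R]_n -> R :=
  foldr (fun i g => pderiv i g) h s.

Definition monom n (alpha : 'I_n -> nat) (x : 'rV[R]_n) : R :=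
  \prod_(i < n) x 0 i ^+ alpha i.

Definition schwartz_real n (h : 'rV[R]_n -> R) : Prop :=
  smooth_real h /\
  forall (alpha : 'I_n -> nat) (s : seq 'I_n),
    exists C : R, forall x, `|monom alpha x * pderivs s h x| <= C.

Definition schwartz n (f : 'rV[R]_n -> R[i]) : Prop :=
  schwartz_real (fun x => complex.Re (f x)) /\ schwartz_real (fun x => complex.Im (f x)).

Definition expi (t : R) : R[i] := Complex (cos t) (sin t).

Definition fourier n (u : 'rV[R]_n -> R[i]) : 'rV[R]_n -> R[i] :=
  fun xi => Rn_int_c (fun x => u x * expi (- dotRn x xi)).

Definition inv_fourier n (v : 'rV[R]_n -> R[i]) : 'rV[R]_n -> R[i] :=
  fun x => Complex ((2 * pi) ^- n) 0 * Rn_int_c (fun xi => v xi * expi (dotRn x xi)).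

Definition fmult n (a u : 'rV[R]_n -> R[i]) : 'rV[R]_n -> R[i] :=
  inv_fourier (fun xi => a xi * fourier u xi).

Definition is_multiplier n (normZ : ('rV[R]_n -> R[i]) -> \bar R)
    (inZ : ('rV[R]_n -> R[i]) -> Prop) (a : 'rV[R]_n -> R[i]) : Prop :=
  (ereal_sup [set (normZ (fmult a u) * ((fine (normZ u))^-1)%:E)%E |
      u in [set u | [/\ schwartz u, inZ u & u <> (fun _ => 0%R)]]] < +oo)%E.

(* X = L^1(R^n, v) with associate space X' = L^oo(R^n, v^{-1}) *)
Definition L1w_norm_fundamental n (v : 'rV[R]_n -> R) : Prop :=
  forall f, in_L1w v f ->
    L1w_norm v f =
    ereal_sup [set (cabs (Rn_int_c (fun x => f x * psi x)))%:E |
                psi in [set psi | C0inf psi /\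
                   (Linfw_norm (fun x => ((v x)^-1)%R) psi <= 1)%E]].

Definition L1w_reflection_invariant n (v : 'rV[R]_n -> R) : Prop :=
  forall f, in_L1w v f -> L1w_norm v f = L1w_norm v (fun x => f (- x)).

Definition unit_cube n : set 'rV[R]_n :=
  [set y | forall i, 0 <= y 0 i <= 1].

Definition e1 n (hn : (0 < n)%N) : 'rV[R]_n := unitv (Ordinal hn).

Definition Gshift n (hn : (0 < n)%N) (G : set 'rV[R]_n) (m : nat) : set 'rV[R]_n :=
  [set y | G (y - (2 * m)%:R *: e1 hn)].

Definition wGb_pos n (hn : (0 < n)%N) (G : set 'rV[R]_n) (b : nat -> R)
    (y : 'rV[R]_n) : R :=
  match pselect (exists m, Gshift hn G m y) with
  | left h => b (proj1_sig (cid h))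
  | right _ => 1
  end.

Definition wGb n (hn : (0 < n)%N) (G : set 'rV[R]_n) (b : nat -> R)
    (y : 'rV[R]_n) : R :=
  if 0 <= y 0 (Ordinal hn) then wGb_pos hn G b y else wGb_pos hn G b (- y).

End Rn.

(* Main.v *)
Require Import Defs.
From HB Require Import structures.
From mathcomp Require Import all_boot all_order all_algebra.
From mathcomp Require Import all_classical all_reals all_analysis.
From mathcomp Require Import complex lra ring zify measurable_realfun.

(** Put u' := F^-1 (a u^), which is the convolution of u with k := F^-1 a.
    The gaps of the union of the translates of G and -G are open and dense, and
    the weight w is 1 there; hence for continuous u the essential supremum of
    |u| w equals sup |u|.  Consequently every a with k in L^1 is a multiplier of
    L^oo(w), whereas a test function psi with |psi| w <= 1 a.e. satisfies
    |psi| <= 1 everywhere and cannot detect the mass 1/b_m that w^-1 puts on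
    G_m.  For the failure on L^1(w^-1), take a a tensor product of narrow even
    bumps, so that k >= c > 0 near 0: if u >= 0 is a bump supported in the slab
    2m+1 < y_1 < 2m+2 next to G_m, then u' >= c ||u|| on G_m, so
    ||u'|| >= c |G| ||u|| / b_m. *)

Set Implicit Arguments.
Unset Strict Implicit.
Unset Printing Implicit Defensive.

Import Order.TTheory GRing.Theory Num.Theory.
Import numFieldNormedType.Exports.

Local Open Scope classical_set_scope.
Local Open Scope ring_scope.

(** * Borel sets and Lebesgue measure on R^n *)

(** The integral of the statement is iterated one-dimensional integration. Steps involving the
    weight rest on its monotonicity, its invariances and pointwise rewriting; Fubini and linearity
    are applied to unweighted Borel functions, for which the same number is an integral against a
    measure [lebn n]. Density of the gaps comes without Baire: a bounded set meets only finitely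
    many translates, each closed with empty interior. Since the symbol and the bumps are products of
    one-variable functions, smoothness, decay and positivity reduce to dimension one. There k in L^1
    follows from k(y) = O(1/(1 + y^2)), and the support [-1/2, 1/2] of the symbol is dictated by
    geometry: points of G_m and of the neighbouring bump differ by at most 2 in each coordinate, so
    each one-variable phase stays in [-1, 1], where cos >= cos 1 > 0. The factors 2 in the upper
    bounds are the price of treating real and imaginary parts separately. *)

Definition Rn (R : realType) n : Type := g_sigma_algebraType (@open 'rV[R]_n).
HB.instance Definition _ (R : realType) n := Measurable.on (Rn R n).

Arguments Rn : clear implicits.

Section Borel.
Context {R : realType}.

Lemma continuous_Rn_measurable n (h : 'rV[R]_n -> R) :
  continuous h -> measurable_fun [set: Rn R n] h.
Proof.
move=> /continuousP ch; apply: (measurability _ (RGenOpens.measurableE R)).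
move=> _ [_ [a [b ->]] <-]; rewrite setTI.
by apply: sub_sigma_algebra; apply: ch; exact: interval_open.
Qed.

Lemma measurable_coord n (i : 'I_n) : measurable_fun [set: Rn R n] (fun x => x 0 i).
Proof. by apply: continuous_Rn_measurable => x; exact: coord_continuous. Qed.

Lemma ball_rVP n (x : 'rV[R]_n) e y :
  ball x e y <-> 0 < e /\ forall i, `|x 0 i - y 0 i| < e.
Proof.
split=> -[e0 h]; split=> // i; first exact: h.
by move=> j; rewrite ord1; exact: h.
Qed.

(** An open set is the countable union of the rational cubes it contains: a centre within r0 < e/2
    of x and radius r0 keep the cube inside the ball of radius e around x. The preimage of a cube is
    a finite intersection of coordinate conditions. *)
Lemma measurable_rV d (T : measurableType d) n (f : T -> Rn R n) :
  (forall i, measurable_fun setT (fun t => f t 0 i)) -> measurable_fun setT f.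
Proof.
move=> mf; apply: (@measurability _ _ T (Rn R n) setT f (@open 'rV[R]_n)) => //.
move=> _ [U oU <-]; rewrite setTI.
pose P (c : 'rV[rat]_n * rat) : set 'rV[R]_n := ball (map_mx (ratr : rat -> R) c.1) (ratr c.2).
have -> : f @^-1` U = \bigcup_(c in [set c | P c `<=` U]) (f @^-1` P c).
  rewrite -preimage_bigcup; congr (_ @^-1` _).
  apply/seteqP; split=> x; last by move=> [c + Pc]; exact.
  move=> Ux; have /nbhs_ballP[e /= e0 eU] := open_nbhs_nbhs (conj oU Ux).
  have [r0 [r00 r0e]] : exists r : rat, 0 < ratr r :> R /\ ratr r < e / 2.
    have /rat_in_itvoo[q] : 0 < e / 2 by rewrite divr_gt0.
    by rewrite in_itv/= => /andP[? ?]; exists q.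
  have /choice[q qP] : forall i, exists q : rat, `|ratr q - x 0 i| < ratr r0 :> R.
    move=> i; have /rat_in_itvoo[q] : x 0 i - ratr r0 < x 0 i + ratr r0 by lra.
    by rewrite in_itv/= => qi; exists q; rewrite ltr_distl.
  exists (\row_i q i, r0); last first.
    by apply/ball_rVP; split=> // i; rewrite !mxE.
  move=> y /ball_rVP[_ yP]; apply: eU; apply/ball_rVP; split=> // i.
  have := qP i; have := yP i; rewrite !mxE => h1 h2.
  rewrite -(subrKA (ratr (q i))) (le_lt_trans (ler_normD _ _))//.
  rewrite (splitr e) ltrD// ?(lt_trans _ r0e)//.
  by rewrite distrC.
rewrite bigcup_mkcond; apply: countable_bigcupT_measurable => // c.
case: ifPn => // _; rewrite /P.
have [c0|c0] := ltP (0 : R) (ratr c.2); last first.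
  rewrite (_ : _ @^-1` _ = set0)//; apply/seteqP; split=> // t /ball_rVP[] /lt_geF.
  by rewrite c0.
have -> : f @^-1` ball (map_mx (ratr : rat -> R) c.1) (ratr c.2) =
    \bigcap_(i in [set: 'I_n])
      ((fun t => f t 0 i) @^-1` `](ratr (c.1 0 i) - ratr c.2), (ratr (c.1 0 i) + ratr c.2)[).
  apply/seteqP; split=> t.
    move=> /ball_rVP[_ h] i _ /=; rewrite in_itv/=; have := h i.
    by rewrite !mxE distrC ltr_distl.
  move=> h; apply/ball_rVP; split=> // i; have := h i I.
  by rewrite /= in_itv/= !mxE distrC ltr_distl.
apply: fin_bigcap_measurable; first exact: finite_finset.
by move=> i _; rewrite -[X in measurable X]setTI; apply: mf.
Qed.

Definition vcons k (t : R) (x : 'rV[R]_k) : 'rV[R]_k.+1 :=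
  \row_i ocons t (fun j => x 0 j) i.

Definition vtail k (x : 'rV[R]_k.+1) : 'rV[R]_k := \row_j x 0 (lift ord0 j).

Lemma vcons0 k t (x : 'rV[R]_k) : vcons t x 0 ord0 = t.
Proof. by rewrite mxE /ocons unlift_none. Qed.

Lemma vconsS k t (x : 'rV[R]_k) j : vcons t x 0 (lift ord0 j) = x 0 j.
Proof. by rewrite mxE /ocons liftK. Qed.

Lemma vconsK k t (x : 'rV[R]_k) : vtail (vcons t x) = x.
Proof. by apply/rowP => j; rewrite mxE vconsS. Qed.

Lemma vcons_tail k (x : 'rV[R]_k.+1) : vcons (x 0 ord0) (vtail x) = x.
Proof.
apply/rowP => j; case: (unliftP ord0 j) => [i ->|->]; last by rewrite vcons0.
by rewrite vconsS mxE.
Qed.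

Lemma measurable_vcons k :
  measurable_fun setT (fun p : R * Rn R k => vcons p.1 p.2 : Rn R k.+1).
Proof.
apply: measurable_rV => i; case: (unliftP ord0 i) => [j ->|->].
  under eq_fun do rewrite vconsS.
  exact: measurableT_comp (measurable_coord j) measurable_snd.
by under eq_fun do rewrite vcons0; exact: measurable_fst.
Qed.

Lemma measurable_vtail k : measurable_fun setT (@vtail k : Rn R k.+1 -> Rn R k).
Proof.
apply: measurable_rV => i; under eq_fun do rewrite mxE.
exact: measurable_coord.
Qed.

Lemma Rn_int_vcons k (h : 'rV[R]_k.+1 -> \bar R) :
  Rn_int h = (\int[lebesgue_measure]_t Rn_int (fun x => h (vcons t x)))%E.
Proof.
rewrite /Rn_int /=; apply: eq_integral => t _; congr iint; apply/funext => g.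
by congr h; apply/rowP => i; rewrite !mxE; congr ocons; apply/funext => j; rewrite mxE.
Qed.

Lemma Rn_int_dim0 (h : 'rV[R]_0 -> \bar R) : Rn_int h = h 0.
Proof. by rewrite /Rn_int /=; congr h; apply/rowP => -[]. Qed.

(* In the library this canonical instance is shadowed by the one for
   subprobabilities. *)
Lemma sigma_finite_prod d1 d2 (T1 : measurableType d1) (T2 : measurableType d2)
    (R' : realType) (m1 : {sigma_finite_measure set T1 -> \bar R'})
    (m2 : {sigma_finite_measure set T2 -> \bar R'}) :
  sigma_finite setT (product_measure1 m1 m2).
Proof.
have /sigma_finiteP[F [FT Fnd Foo]] := sigma_finiteT m1.
have /sigma_finiteP[G [GT Gnd Goo]] := sigma_finiteT m2.
exists (fun n => F n `*` G n).
  rewrite -setXTT FT GT; apply/seteqP; split=> -[x y] /=; last first.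
    by move=> [n _ [Fx Gy]]; split; exists n.
  move=> [[n _ Fx] [p _ Gy]]; exists (maxn n p) => //; split => /=.
    by move: x Fx; exact/subsetPset/Fnd/leq_maxl.
  by move: y Gy; exact/subsetPset/Gnd/leq_maxr.
move=> p; have [mF Fp] := Foo p; have [mG Gp] := Goo p; split.
  exact: measurableX.
by rewrite product_measure1E// lte_mul_pinfty// ge0_fin_numE.
Qed.

(** Induction on the dimension: the Dirac mass at the only point of R^0, then the pushforward under
    [vcons] of Lebesgue measure times the measure already built. Tonelli turns the latter into the
    iterated integral. *)
Lemma exists_lebesgue_Rn n : exists mu : {sigma_finite_measure set (Rn R n) -> \bar R},
  forall h : Rn R n -> \bar R, measurable_fun [set: Rn R n] h -> (forall x, 0 <= h x)%E ->
  Rn_int h = (\int[mu]_x h x)%E.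
Proof.
elim: n => [|k [mu muE]].
  exists (\d_ (0 : Rn R 0)) => h mh h0; rewrite integral_dirac// diracE in_setT mul1e.
  exact: Rn_int_dim0.
pose phi (p : R * Rn R k) : Rn R k.+1 := vcons p.1 p.2.
have mphi : measurable_fun setT phi by exact: measurable_vcons.
pose nu : {measure set (Rn R k.+1) -> \bar R} :=
  measure_function_pushforward__canonical__measure_function_Measure
    (product_measure1 lebesgue_measure mu) mphi.
(* The cover of the product is pulled back along (head, tail), the inverse of [phi]. *)
have snu : sigma_finite setT nu.
  have [F FT FP] := @sigma_finite_prod _ _ (measurableTypeR R) (Rn R k) R
    lebesgue_measure mu.
  exists (fun i => (fun x : Rn R k.+1 => (x 0 ord0, vtail x : Rn R k)) @^-1` F i).
    by rewrite -preimage_bigcup -FT preimage_setT.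
  move=> i; have [mF Foo] := FP i; split.
    rewrite -[X in measurable X]setTI.
    apply: (measurable_fun_pair (measurable_coord ord0) (@measurable_vtail k)) => //.
  rewrite /= /pushforward (_ : _ @^-1` _ = F i)//.
  by apply/seteqP; split=> -[t x]; rewrite /= vcons0 vconsK.
pose nu' : {sigma_finite_measure set (Rn R k.+1) -> \bar R} :=
  HB.pack (Measure.sort nu) (Measure.class nu) (Measure_isSigmaFinite.Build _ _ _ nu snu).
exists nu' => h mh h0.
rewrite /nu' /= ge0_integral_pushforward//= preimage_setT.
rewrite fubini_tonelli1//; last exact: measurableT_comp.
rewrite Rn_int_vcons; apply: eq_integral => t _.
rewrite muE//.
exact: (measurableT_comp mh (measurableT_comp mphi (measurable_pair1 t))).
Qed.
End Borel.

(** * Invariance of one-dimensional integrals of nonnegative functions *)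

Section OneDim.
Local Open Scope ereal_scope.
Import HBNNSimple.

(** The integral of a nonnegative function is a supremum over the simple functions below it, and
    that family grows with the function. *)
Lemma ge0_integral_mono d (T : measurableType d) (R : realType)
    (mu : {measure set T -> \bar R}) (f g : T -> \bar R) :
  (forall x, 0 <= f x) -> (forall x, f x <= g x) ->
  \int[mu]_x f x <= \int[mu]_x g x.
Proof.
move=> f0 fg; rewrite !ge0_integralTE//; last by move=> x; exact: le_trans (fg x).
by apply: le_ereal_sup => _ [h hf <-]; exists h => // x; exact: le_trans (fg x).
Qed.

(* Transfers facts from measurable integrands to arbitrary nonnegative ones, so
   that the weight never has to be shown Borel. *)
Lemma ge0_integral_supP d (T : measurableType d) (R : realType)
    (mu : {measure set T -> \bar R}) (f : T -> \bar R) (M : \bar R) :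
  (forall x, 0 <= f x) ->
  (forall h : T -> \bar R, measurable_fun setT h -> (forall x, 0 <= h x) ->
    (forall x, h x <= f x) -> \int[mu]_x h x <= M) ->
  \int[mu]_x f x <= M.
Proof.
move=> f0 hM; rewrite ge0_integralTE//; apply: ge_ereal_sup => _ [h hf <-].
rewrite -integralT_nnsfun; apply: hM => //.
  by apply/measurable_EFinP.
by move=> x; rewrite lee_fin.
Qed.

Context {R : realType}.
Local Notation leb := (@lebesgue_measure R).
Local Notation RL := (measurableTypeR R).

(** One inequality follows by transporting the measurable minorants of f through the
    measure-preserving [phi]; the other is the same fact for [f \o phi] and [psi]. *)
Lemma ge0_integral_comp_invariant (phi psi : RL -> RL) (f : RL -> \bar R) :
  measurable_fun setT phi -> measurable_fun setT psi ->
  cancel phi psi -> cancel psi phi ->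
  (forall A, measurable A -> leb (phi @^-1` A) = leb A) ->
  (forall A, measurable A -> leb (psi @^-1` A) = leb A) ->
  (forall x, 0 <= f x) -> \int[leb]_x f (phi x) = \int[leb]_x f x.
Proof.
move=> mphi mpsi phiK psiK lphi lpsi f0.
have key (g : RL -> \bar R) (th : RL -> RL) : measurable_fun setT th ->
    (forall A, measurable A -> leb (th @^-1` A) = leb A) ->
    (forall x, 0 <= g x) -> \int[leb]_x g x <= \int[leb]_x g (th x).
  move=> mth lth g0; apply: ge0_integral_supP => // h mh h0 hg.
  have -> : \int[leb]_x h x = \int[pushforward leb th]_x h x.
    apply: (@eq_measure_integral _ _ _ setT
      (measure_function_pushforward__canonical__measure_function_Measure leb mth) leb).
    by move=> A mA _ /=; rewrite -lth.
  rewrite ge0_integral_pushforward//= preimage_setT.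
  by apply: ge0_integral_mono => x /=.
apply/eqP; rewrite eq_le; apply/andP; split; last exact: key.
have := key (f \o phi) psi mpsi lpsi (fun x => f0 _).
by under [X in (_ <= X)%E]eq_integral do rewrite /= psiK.
Qed.

Lemma ge0_integral_reflect (f : R -> \bar R) : (forall x, 0 <= f x) ->
  \int[leb]_x f (- x)%R = \int[leb]_x f x.
Proof.
move=> f0.
apply: (@ge0_integral_comp_invariant (fun x => (- x)%R) (fun x => (- x)%R)) => //.
- exact: (@oppr_measurable R setT).
- exact: (@oppr_measurable R setT).
- exact: (@opprK R).
- exact: (@opprK R).
- exact: lebesgue_measureN.
- exact: lebesgue_measureN.
Qed.

(** Uniqueness of Lebesgue measure: the translated measure agrees with it on half-open intervals. *)
Lemma lebesgue_measure_translate (c : R) (A : set R) : measurable A ->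
  leb ((fun x => x + c)%R @^-1` A) = leb A.
Proof.
move=> mA.
have mphi : measurable_fun [set: RL] ((fun x : R => x + c)%R : RL -> RL).
  exact: (@measurable_funD _ RL R setT id (cst _)).
pose nu : {measure set RL -> \bar R} :=
  measure_function_pushforward__canonical__measure_function_Measure leb mphi.
apply/esym/(lebesgue_measure_unique (mu := nu)) => //= _ [[a b]] _ <-.
rewrite /pushforward.
have -> : (fun x : R => (x + c)%R) @^-1` `]a, b] = `](a - c)%R, (b - c)%R]%classic.
  by apply/seteqP; split=> x /=; rewrite !in_itv/= ltrBlDr lerBrDr.
by rewrite !lebesgue_measure_itv/= !lte_fin ltrD2r -!EFinB opprD opprK addrACA addNr addr0.
Qed.

Lemma ge0_integral_translate (c : R) (f : R -> \bar R) : (forall x, 0 <= f x) ->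
  \int[leb]_x f (x + c)%R = \int[leb]_x f x.
Proof.
move=> f0.
apply: (@ge0_integral_comp_invariant (fun x => x + c)%R (fun x => x + - c)%R) => //.
- exact: (@measurable_funD _ R R setT id (cst _)).
- exact: (@measurable_funD _ R R setT id (cst _)).
- exact: (@addrK R c).
- exact: (@subrK R c).
- exact: lebesgue_measure_translate.
- exact: lebesgue_measure_translate.
Qed.

(** Serves to discard the hyperplane y_1 = 0, which is a single point of the outermost integration
    variable. *)
Lemma ge0_integral_eq_except (a : R) (f g : R -> \bar R) :
  (forall x, 0 <= f x) -> (forall x, 0 <= g x) -> (forall x, x != a -> f x = g x) ->
  \int[leb]_x f x = \int[leb]_x g x.
Proof.
suff key (f' g' : R -> \bar R) : (forall x, 0 <= f' x) -> (forall x, 0 <= g' x) ->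
    (forall x, x != a -> f' x = g' x) -> \int[leb]_x f' x <= \int[leb]_x g' x.
  move=> f0 g0 fg; apply/eqP; rewrite eq_le !key//.
  by move=> x xa; rewrite fg.
move=> f0 g0 fg; apply: ge0_integral_supP => // h mh h0 hf.
rewrite (@ge0_negligible_integral _ RL R leb setT [set (a : RL)])//; last first.
  exact: lebesgue_measure_set1.
rewrite integral_mkcond; apply: ge0_integral_mono => x.
  by rewrite patchE; case: ifPn.
rewrite patchE; case: ifPn => // /set_mem [_ /eqP xa].
by rewrite (le_trans (hf x))// fg.
Qed.

End OneDim.

(** * Lebesgue measure on R^n and the symmetries of the iterated integral *)

Section LebesgueRn.
Context {R : realType}.
Local Notation leb := (@lebesgue_measure R).

(** A measure picked by choice separately in each dimension; beyond sigma-finiteness, all that is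
    known of it comes through [Rn_intE]. *)
Definition lebn n : {sigma_finite_measure set (Rn R n) -> \bar R} :=
  sval (cid (@exists_lebesgue_Rn R n)).

Lemma Rn_intE n (h : Rn R n -> \bar R) : measurable_fun [set: Rn R n] h ->
  (forall x, 0 <= h x)%E -> Rn_int h = (\int[lebn n]_x h x)%E.
Proof. by rewrite /lebn; case: cid => mu /= H; exact: H. Qed.

Lemma Rn_int_ge0 n (h : 'rV[R]_n -> \bar R) : (forall x, 0 <= h x)%E ->
  (0 <= Rn_int h)%E.
Proof.
elim: n h => [|n IH] h h0; first by rewrite Rn_int_dim0.
by rewrite Rn_int_vcons; apply: integral_ge0 => t _; exact: IH.
Qed.

Lemma Rn_int_mono n (h k : 'rV[R]_n -> \bar R) : (forall x, 0 <= h x)%E ->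
  (forall x, h x <= k x)%E -> (Rn_int h <= Rn_int k)%E.
Proof.
elim: n h k => [|n IH] h k h0 hk; first by rewrite !Rn_int_dim0.
rewrite !Rn_int_vcons; apply: ge0_integral_mono => t; first exact: Rn_int_ge0.
exact: IH.
Qed.

Lemma eq_Rn_int n (h k : 'rV[R]_n -> \bar R) : h =1 k -> Rn_int h = Rn_int k.
Proof. by move=> /funext ->. Qed.

Lemma vconsN n t (x : 'rV[R]_n) : - vcons t x = vcons (- t) (- x).
Proof.
apply/rowP => i; rewrite mxE; case: (unliftP ord0 i) => [j ->|->].
  by rewrite !vconsS mxE.
by rewrite !vcons0.
Qed.

Lemma Rn_int_reflect n (h : 'rV[R]_n -> \bar R) : (forall x, 0 <= h x)%E ->
  Rn_int (fun x => h (- x)) = Rn_int h.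
Proof.
elim: n h => [|n IH] h h0; first by rewrite !Rn_int_dim0 oppr0.
rewrite !Rn_int_vcons -[RHS]ge0_integral_reflect; last by move=> t; exact: Rn_int_ge0.
apply: eq_integral => t _; rewrite -(IH (fun x => h (vcons (- t) x)))//.
by apply: eq_Rn_int => x; rewrite vconsN.
Qed.

Lemma Rn_int_translate_head n (c : R) (h : 'rV[R]_n.+1 -> \bar R) :
  (forall x, 0 <= h x)%E ->
  Rn_int (fun x => h (x + c *: delta_mx 0 ord0)) = Rn_int h.
Proof.
move=> h0; rewrite !Rn_int_vcons -[RHS](ge0_integral_translate c); last first.
  by move=> t; exact: Rn_int_ge0.
apply: eq_integral => t _; apply: eq_Rn_int => x; congr h.
apply/rowP => i; rewrite [LHS]mxE [X in _ + X]mxE [X in _ * X]mxE eqxx.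
case: (unliftP ord0 i) => [j ->|->]; first by rewrite !vconsS mulr0 addr0.
by rewrite !vcons0 eqxx mulr1.
Qed.

Lemma Rn_int_eq_head n (h k : 'rV[R]_n.+1 -> \bar R) :
  (forall x, 0 <= h x)%E -> (forall x, 0 <= k x)%E ->
  (forall x : 'rV[R]_n.+1, x 0 ord0 != 0 -> h x = k x) -> Rn_int h = Rn_int k.
Proof.
move=> h0 k0 hk; rewrite !Rn_int_vcons; apply: (@ge0_integral_eq_except _ 0).
- by move=> t; exact: Rn_int_ge0.
- by move=> t; exact: Rn_int_ge0.
- by move=> t t0; apply: eq_Rn_int => x; rewrite hk// vcons0.
Qed.

Lemma Rn_int_realE n (h : Rn R n -> R) : measurable_fun [set: Rn R n] h ->
  Rn_int_real h = \int[lebn n]_x h x.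
Proof.
move=> mh; rewrite /Rn_int_real /Rintegral integralE; congr (fine (_ - _)%E).
  rewrite Rn_intE.
  - by apply: eq_integral => x _; rewrite funeposE EFin_max.
  - by apply/measurable_EFinP; exact: measurable_maxr.
  - by move=> x; rewrite lee_fin le_max lexx orbT.
rewrite Rn_intE.
- by apply: eq_integral => x _; rewrite funenegE EFin_max.
- apply/measurable_EFinP; apply: measurable_maxr => //.
  exact: measurableT_comp.
- by move=> x; rewrite lee_fin le_max lexx orbT.
Qed.

End LebesgueRn.

(** * Fubini for head and tail, and integrals of products of one-variable functions *)

Section Tensor.
Context {R : realType}.
Local Notation RL := (measurableTypeR R).
Local Notation leb := (@lebesgue_measure R).
Local Open Scope ereal_scope.

Lemma integrable_prodfun d1 d2 (T1 : measurableType d1) (T2 : measurableType d2)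
    (m1 : {sigma_finite_measure set T1 -> \bar R})
    (m2 : {sigma_finite_measure set T2 -> \bar R}) (f : T1 -> R) (g : T2 -> R) :
  m1.-integrable setT (EFin \o f) -> m2.-integrable setT (EFin \o g) ->
  (product_measure1 m1 m2).-integrable setT (fun p => (f p.1 * g p.2)%:E) /\
  \int[product_measure1 m1 m2]_p (f p.1 * g p.2)%:E =
    \int[m1]_x (f x)%:E * \int[m2]_x (g x)%:E.
Proof.
move=> fi gi.
have mf : measurable_fun setT f by apply/measurable_EFinP; exact: measurable_int fi.
have mg : measurable_fun setT g by apply/measurable_EFinP; exact: measurable_int gi.
have mfg : measurable_fun setT (fun p : T1 * T2 => (f p.1 * g p.2)%:E).
  apply/measurable_EFinP; apply: measurable_funM.
    exact: (measurableT_comp mf measurable_fst).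
  exact: (measurableT_comp mg measurable_snd).
have [_ foo] := integrableP _ _ _ fi.
have [_ goo] := integrableP _ _ _ gi.
have intfg : (product_measure1 m1 m2).-integrable setT (fun p => (f p.1 * g p.2)%:E).
  have /iffRL := @integrable12ltyP _ _ T1 T2 R m1 m2 _ mfg; apply => /=.
  have -> : \int[m1]_x \int[m2]_y `|(f x * g y)%:E| =
      \int[m1]_x (`|(f x)%:E| * \int[m2]_y `|(g y)%:E|).
    apply: eq_integral => x _; rewrite -ge0_integralZl//.
    - by apply: eq_integral => y _; rewrite EFinM abseM.
    - by apply: measurableT_comp => //; exact/measurable_EFinP.
  rewrite ge0_integralZr//.
  - rewrite lte_mul_pinfty//; first exact: integral_ge0.
    by rewrite ge0_fin_numE//; exact: integral_ge0.
  - by apply: measurableT_comp => //; exact/measurable_EFinP.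
  - exact: integral_ge0.
split=> //; rewrite -integral12_prod_meas1//=.
have g_fin : \int[m2]_y (g y)%:E \is a fin_num := integrable_fin_num measurableT gi.
transitivity (\int[m1]_x ((f x)%:E * (fine (\int[m2]_y (g y)%:E))%:E)).
  apply: eq_integral => x _; rewrite fineK// -integralZl//.
rewrite integralZr//; last by rewrite fineK.
Qed.

Let phi k (p : RL * Rn R k) : Rn R k.+1 := vcons p.1 p.2.

Let mphi k : measurable_fun [set: RL * Rn R k] (@phi k).
Proof. exact: measurable_vcons. Qed.

(** The measures [lebn k] and [lebn k.+1] come from independent choices, so their relation is
    recovered by integrating an indicator: both sides equal its iterated integral. *)
Lemma lebn_pushforward k (A : set (Rn R k.+1)) : measurable A ->
  lebn k.+1 A = product_measure1 leb (lebn k) ((fun p => vcons p.1 p.2) @^-1` A).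
Proof.
move=> mA.
have mI : measurable_fun [set: Rn R k.+1] (fun x => (\1_A x)%:E : \bar R).
  by apply/measurable_EFinP; exact: measurable_indic.
rewrite -[X in lebn _ X](setIT A) -integral_indic// -Rn_intE//.
rewrite Rn_int_vcons.
have mB : measurable ((@phi k) @^-1` A) by rewrite -[X in measurable X]setTI; exact: mphi.
rewrite -[X in product_measure1 _ _ X]setIT -integral_indic// fubini_tonelli1//; last first.
  by apply/measurable_EFinP; exact: measurable_indic.
apply: eq_integral => t _; rewrite Rn_intE//.
exact: (measurableT_comp mI (measurableT_comp (@mphi k) (measurable_pair1 t))).
Qed.

Lemma integral_lebn_vcons k (F : Rn R k.+1 -> \bar R) : measurable_fun setT F ->
  (product_measure1 leb (lebn k)).-integrable setT (fun p => F (vcons p.1 p.2)) ->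
  (lebn k.+1).-integrable setT F /\
  \int[lebn k.+1]_x F x = \int[product_measure1 leb (lebn k)]_p F (vcons p.1 p.2).
Proof.
move=> mF Fi.
have eqm (H : Rn R k.+1 -> \bar R) : \int[lebn k.+1]_x H x =
    \int[pushforward (product_measure1 leb (lebn k)) (@phi k)]_x H x.
  apply: (@eq_measure_integral _ _ _ setT
    (measure_function_pushforward__canonical__measure_function_Measure
      (product_measure1 leb (lebn k)) (@mphi k))).
  by move=> A mA _; exact: lebn_pushforward.
split; last first.
  by rewrite eqm integral_pushforward.
have /integrableP[_] := integrable_pushforward (@mphi k) mF (D := setT) Fi measurableT.
by rewrite -eqm => Foo; apply/integrableP.
Qed.

End Tensor.

Section TensorR.
Context {R : realType}.
Local Notation RL := (measurableTypeR R).
Local Notation leb := (@lebesgue_measure R).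

Definition tensor n (f : 'I_n -> R -> R) (x : 'rV[R]_n) : R := \prod_i f i (x 0 i).

Lemma tensor_vcons n (f : 'I_n.+1 -> R -> R) t (x : 'rV[R]_n) :
  tensor f (vcons t x) = f ord0 t * tensor (fun i => f (lift ord0 i)) x.
Proof.
rewrite /tensor big_ord_recl vcons0; congr (_ * _).
by apply: eq_bigr => i _; rewrite vconsS.
Qed.

Lemma integrable_head_tail n (f : RL -> R) (g : Rn R n -> R) (F : Rn R n.+1 -> R) :
  leb.-integrable setT (EFin \o f) -> (lebn n).-integrable setT (EFin \o g) ->
  (forall t x, F (vcons t x) = f t * g x) ->
  (lebn n.+1).-integrable setT (EFin \o F) /\
  (\int[lebn n.+1]_x F x = (\int[leb]_x f x) * (\int[lebn n]_x g x))%R.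
Proof.
move=> fi gi FE.
have [i1 e1] := integrable_prodfun fi gi.
have mF : measurable_fun setT F.
  have -> : F = (fun x : Rn R n.+1 => f (x 0 ord0) * g (vtail x)).
    by apply/funext => x; rewrite -FE vcons_tail.
  apply: measurable_funM.
    apply: (measurableT_comp (f := f)); last exact: measurable_coord.
    by apply/measurable_EFinP; exact: measurable_int fi.
  apply: (measurableT_comp (f := g)); last exact: measurable_vtail.
  by apply/measurable_EFinP; exact: measurable_int gi.
have [] := @integral_lebn_vcons R n (EFin \o F).
- exact/measurable_EFinP.
- by apply: eq_integrable i1 => // p _; rewrite /= FE.
move=> Fi eF; split=> //; rewrite /Rintegral eF -fineM; last 2 first.
- exact: integrable_fin_num.
- exact: integrable_fin_num.
by rewrite -e1; congr fine; apply: eq_integral => p _; rewrite /= FE.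
Qed.

Lemma integral_lebn_dim0 (h : Rn R 0 -> R) :
  (lebn 0).-integrable setT (EFin \o h) /\ \int[lebn 0]_x h x = h 0.
Proof.
have hE : h = cst (h 0) by apply/funext => x; congr h; apply/rowP => -[].
have l1 : lebn 0 [set: Rn R 0] = 1%E.
  by rewrite -[LHS]mul1e -integral_cst// -Rn_intE.
rewrite hE; move: (h 0) => c.
have hi : (lebn 0).-integrable setT (EFin \o cst c : Rn R 0 -> \bar R).
  apply/integrableP; split; first exact/measurable_EFinP.
  rewrite -[X in (X < _)%E]/(\int[lebn 0]_x cst `|c%:E| x)%E integral_cst//.
  by rewrite -[X in (X < _)%E]/(`|c%:E| * lebn 0 [set: Rn R 0])%E l1 mule1 ltry.
split => //; rewrite Rintegral_cst//.
by rewrite -[LHS]/(c * fine (lebn 0 [set: Rn R 0])) l1/= mulr1.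
Qed.

Lemma integrable_tensor n (f : 'I_n -> R -> R) :
  (forall i, leb.-integrable setT (EFin \o f i)) ->
  (lebn n).-integrable setT (EFin \o tensor f) /\
  \int[lebn n]_x tensor f x = \prod_i \int[leb]_t f i t.
Proof.
elim: n f => [|n IH] f fi.
  have [? ->] := integral_lebn_dim0 (tensor f); split=> //.
  by rewrite /tensor !big_ord0.
have [i1 e1] := IH (fun i => f (lift ord0 i)) (fun i => fi _).
have [? ->] := integrable_head_tail (fi ord0) i1 (tensor_vcons f).
by rewrite e1 big_ord_recl.
Qed.

End TensorR.

(** * Smooth bump functions *)

Section Smooth1.
Context {R : realType}.
Implicit Types f g : R -> R.

(** The derivative is supplied as a witness, so that closure under sums, products and affine
    substitution can exhibit it as a formula and recurse on it. *)
Fixpoint Ck1 (k : nat) f : Prop :=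
  match k with
  | 0 => continuous f
  | k'.+1 => exists f', (forall x : R, is_derive x 1 f (f' x)) /\ Ck1 k' f'
  end.

Lemma is_derive_continuous f f' : (forall x : R, is_derive x 1 f (f' x)) -> continuous f.
Proof.
by move=> fd x; apply: differentiable_continuous; apply/derivable1_diffP; case: (fd x).
Qed.

Lemma Ck1S k f : Ck1 k.+1 f -> Ck1 k f.
Proof.
elim: k f => [|k IH] f [f' [fd f'D]]; first exact: is_derive_continuous fd.
by exists f'; split=> //; exact: IH.
Qed.

Lemma Ck1_continuous k f : Ck1 k f -> continuous f.
Proof. by elim: k f => // k IH f /Ck1S; exact: IH. Qed.

Lemma Ck1D k f g : Ck1 k f -> Ck1 k g -> Ck1 k (f \+ g).
Proof.
elim: k f g => [|k IH] f g; first by move=> cf cg x; apply: cvgD; [exact: cf|exact: cg].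
move=> [f' [fd fk]] [g' [gd gk]]; exists (f' \+ g'); split; last exact: IH.
by move=> x; exact: is_deriveD.
Qed.

Lemma Ck1M k f g : Ck1 k f -> Ck1 k g -> Ck1 k (f \* g).
Proof.
elim: k f g => [|k IH] f g; first by move=> cf cg x; apply: cvgM; [exact: cf|exact: cg].
move=> fk1 gk1; have [f' [fd fk]] := fk1; have [g' [gd gk]] := gk1.
exists (fun x => f x * g' x + g x * f' x); split.
  by move=> x; exact: is_deriveM.
by apply: Ck1D; apply: IH => //; exact: Ck1S.
Qed.

Lemma Ck1_affine k f (c d : R) : Ck1 k f -> Ck1 k (fun x => f (c * x + d)).
Proof.
elim: k f => [|k IH] f.
  move=> cf x; apply: (@continuous_comp _ _ _ (fun x => c * x + d) f); last exact: cf.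
  by apply: cvgD; [apply: cvgM; [exact: cvg_cst|exact: cvg_id]|exact: cvg_cst].
move=> [f' [fd fk]]; exists (fun x => c * f' (c * x + d)); split; last first.
  apply: (@Ck1M k (cst c) (fun x => f' (c * x + d))); last exact: IH.
  elim: (k) => [|j IHj]; first by move=> x; exact: cvg_cst.
  have D0 : forall i, Ck1 i (cst 0 : R -> R).
    elim=> [|i IHi]; first by move=> x; exact: cvg_cst.
    by exists (cst 0); split=> // x; exact: is_derive_cst.
  by exists (cst 0); split=> // x; exact: is_derive_cst.
move=> x.
have da : is_derive x 1 (fun x => c * x + d) c.
  have h1 : is_derive x 1 (c \*: id + cst d) (c *: (1 : R) + 0) by exact: is_deriveD.
  by move: h1; rewrite addr0 /GRing.scale /= mulr1.
have := @is_derive1_comp _ f (fun x => c * x + d) x _ _ (fd (c * x + d)) da.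
by rewrite mulrC.
Qed.

(** Each monomial obeys s^i <= i! e^s for s >= 0, by the Taylor series; C collects these
    factorials. *)
Lemma poly_le_expR (p : {poly R}) : exists2 C, 0 <= C &
  forall s, 0 <= s -> `|p.[s]| <= C * expR s.
Proof.
exists (\sum_(i < size p) `|p`_i| * i`!%:R).
  by apply: sumr_ge0 => i _; rewrite mulr_ge0.
move=> s s0; rewrite horner_coef mulr_suml (le_trans (ler_norm_sum _ _ _))//.
apply: ler_sum => i _; rewrite normrM -mulrA ler_wpM2l//.
rewrite ger0_norm ?exprn_ge0//; case: (i : nat) => [|m].
  by rewrite expr0 mul1r -expR0 ler_expR.
rewrite mulrC -ler_pdivrMr ?ltr0n ?fact_gt0//.
by rewrite (le_trans _ (expR_ge1Dxn m s0))// lerDr.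
Qed.

(* This class of flat functions is closed under differentiation. *)
Definition poly_expV (p : {poly R}) (t : R) : R :=
  if 0 < t then p.[t^-1] * expR (- t^-1) else 0.

(** The bound [poly_le_expR] for X^2 p at s = 1/t reads t^-2 |p(1/t)| <= C e^(1/t). This quadratic
    flatness gives the derivative 0 at the origin. *)
Lemma poly_expV_le_sqr (p : {poly R}) : exists C, forall t, `|poly_expV p t| <= C * t ^+ 2.
Proof.
have [C C0 hC] := poly_le_expR ('X^2 * p); exists C => t; rewrite /poly_expV.
case: ifPn => [t0|_]; last by rewrite normr0 mulr_ge0// sqr_ge0.
have ti0 : 0 <= t^-1 by rewrite invr_ge0 ltW.
have := hC _ ti0; rewrite hornerM hornerXn normrM => h.
rewrite normrM (ger0_norm (expR_ge0 _)) expRN.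
rewrite ler_pdivrMr ?expR_gt0//.
rewrite -(ler_pM2l (_ : 0 < (t^-1) ^+ 2)) ?exprn_gt0 ?invr_gt0//.
rewrite -[X in X * `|_|]ger0_norm ?exprn_ge0// (le_trans h)//.
by rewrite exprVn mulrAC [in X in _ <= X]mulrCA mulVf ?mulr1// expf_neq0// gt_eqF.
Qed.

Lemma is_derive0_sqr f (x C : R) : (forall h, `|f (x + h) - f x| <= C * h ^+ 2) ->
  is_derive x 1 f 0.
Proof.
move=> fC.
have : (fun h => h^-1 *: ((f \o shift x) (h *: (1 : R)) - f x)) @ 0^' --> (0 : R).
  apply/cvgrPdist_le => e e0.
  have C1 : 0 < `|C| + 1 by rewrite ltr_wpDl.
  near=> h; rewrite sub0r normrN.
  have h0 : h != 0 by near: h; exact: nbhs_dnbhs_neq.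
  rewrite /GRing.scale /= mulr1 normrM [h + x]addrC.
  rewrite normfV ler_pdivrMl ?normr_gt0//.
  rewrite (le_trans (fC h))// (le_trans (ler_norm _))// normrM normrX expr2.
  rewrite mulrA mulrC ler_wpM2l// .
  rewrite (@le_trans _ _ ((`|C| + 1) * `|h|))//; first by rewrite ler_wpM2r// lerDl.
  rewrite -ler_pdivlMl//; near: h.
  by apply: dnbhs0_le; rewrite mulr_gt0// invr_gt0.
by move=> fl; apply: DeriveDef; [apply/cvg_ex; exists 0|exact/cvg_lim].
Unshelve. all: by end_near. Qed.

(** With s = 1/t and ds/dt = - s^2, the derivative of p(s) e^(-s) is s^2 (p(s) - p'(s)) e^(-s),
    again of the same form; at t = 0 the quadratic bound takes over. *)
Lemma is_derive_poly_expV (p : {poly R}) (t : R) :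
  is_derive t 1 (poly_expV p) (poly_expV ('X^2 * (p - p^`())) t).
Proof.
have [t0|t0|<-] := ltgtP 0 t.
- rewrite [X in is_derive _ _ _ X]/poly_expV t0.
  apply: (@near_eq_is_derive R R R (fun x : R => p.[x^-1] * expR (- x^-1))).
    near=> x; rewrite /poly_expV (_ : 0 < x)//.
    by near: x; apply: open_nbhs_nbhs; split=> //; exact: open_gt.
  have tn0 : t != 0 by rewrite gt_eqF.
  have iv : is_derive t 1 (fun x : R => x^-1) (- t^-1 ^+ 2).
    apply: DeriveDef; first exact: derivableV.
    by rewrite deriveV// derive_id /GRing.scale /= mulr1 exprVn.
  have ivN : is_derive t 1 (fun x : R => - x^-1) (t^-1 ^+ 2).
    by have := @is_deriveN _ _ _ _ _ _ _ iv; rewrite opprK.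
  have h1 := is_derive1_comp (is_derive_poly p t^-1) iv.
  have h2 := @is_derive1_comp R expR (fun x : R => - x^-1) t _ _ (is_derive_expR (- t^-1)) ivN.
  have := is_deriveM h1 h2; congr is_derive.
  rewrite /= /GRing.scale /= hornerM hornerXn hornerD hornerN; ring.
- rewrite [X in is_derive _ _ _ X]/poly_expV ltNge (ltW t0)/=.
  apply: (@near_eq_is_derive R R R (cst 0)).
  near=> x; rewrite /poly_expV ltNge (_ : x <= 0)//; apply: ltW.
  by near: x; apply: open_nbhs_nbhs; split=> //; exact: open_lt.
- have [C hC] := poly_expV_le_sqr p.
  rewrite [X in is_derive _ _ _ X]/poly_expV ltxx.
  apply: (@is_derive0_sqr _ _ C) => h; rewrite add0r [poly_expV p 0]/poly_expV ltxx subr0.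
  exact: hC.
Unshelve. all: by end_near. Qed.

Lemma Ck1_poly_expV k (p : {poly R}) : Ck1 k (poly_expV p).
Proof.
elim: k p => [|k IH] p; first exact: is_derive_continuous (is_derive_poly_expV p).
by exists (poly_expV ('X^2 * (p - p^`()))); split=> //; exact: is_derive_poly_expV.
Qed.

(** Equals exp(-2 / (1 - t^2)) on ]-1, 1[ and 0 elsewhere. The factors [1 *] and [- 1 *] give the
    arguments the shape expected by [Ck1_affine]. *)
Definition sbump (t : R) : R := poly_expV 1 (1 * t + 1) * poly_expV 1 (- 1 * t + 1).

Lemma Ck1_sbump k : Ck1 k sbump.
Proof. by apply: Ck1M; apply: Ck1_affine; exact: Ck1_poly_expV. Qed.

Lemma sbumpN t : sbump (- t) = sbump t.
Proof. by rewrite /sbump mulrC !mulN1r !mul1r opprK. Qed.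

Lemma sbump_ge0 t : 0 <= sbump t.
Proof.
have g0 s : 0 <= poly_expV 1 s.
  by rewrite /poly_expV; case: ifP => // s0; rewrite hornerC mul1r expR_ge0.
exact: mulr_ge0.
Qed.

Lemma sbump_eq0 t : 1 <= `|t| -> sbump t = 0.
Proof.
rewrite /sbump /poly_expV mul1r mulN1r ler_normr => /orP[t1|t1].
  by rewrite [X in _ * (if X then _ else _)]ltNge (_ : - t + 1 <= 0) ?mulr0//; lra.
by rewrite ltNge (_ : t + 1 <= 0) ?mul0r//; lra.
Qed.

Lemma sbump_gt0 t : `|t| < 1 -> 0 < sbump t.
Proof.
rewrite ltr_norml => /andP[t1 t2]; rewrite /sbump /poly_expV mul1r mulN1r.
rewrite !ifT; [|lra|lra].
by rewrite !hornerC !mul1r mulr_gt0// expR_gt0.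
Qed.
End Smooth1.

(** * Smoothness of tensor products and the Schwartz class *)

Section Tensor.
Context {R : realType}.

Lemma tensor_continuous n (f : 'I_n -> R -> R) :
  (forall i, continuous (f i)) -> continuous (tensor f).
Proof.
move=> fc; rewrite /tensor.
have h (r : seq 'I_n) : continuous (fun x : 'rV[R]_n => \prod_(i <- r) f i (x 0 i)).
  elim: r => [|i r IH] x.
    rewrite (_ : (fun _ => _) = cst 1); first exact: cst_continuous.
    by apply/funext => y; rewrite big_nil.
  rewrite (_ : (fun _ => _) = (fun y : 'rV[R]_n => f i (y 0 i)) \*
    (fun y => \prod_(j <- r) f j (y 0 j))); last first.
    by apply/funext => y; rewrite big_cons.
  have hi : continuous (fun y : 'rV[R]_n => f i (y 0 i)).
    by move=> y; apply: continuous_comp; [exact: coord_continuous|exact: fc].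
  exact: (continuousM (hi x) (IH x)).
exact: h.
Qed.

(** Moving along the i-th axis changes only the i-th factor, so the difference quotient is exactly
    the other factors times the one-variable quotient. *)
Lemma is_derive_tensor n (f : 'I_n -> R -> R) i (x : 'rV[R]_n) (d : R) :
  is_derive (x 0 i) 1 (f i) d ->
  is_derive x (unitv R i) (tensor f) ((\prod_(j | j != i) f j (x 0 j)) * d).
Proof.
move=> fd; set P := \prod_(j | j != i) f j (x 0 j).
have e : (fun h => h^-1 *: ((tensor f \o shift x) (h *: unitv R i) - tensor f x)) =
   P \*: (fun h => h^-1 *: ((f i \o shift (x 0 i)) (h *: (1:R)) - f i (x 0 i))).
  apply/funext => h /=; rewrite /GRing.scale /= mulrCA; congr (_ * _).
  rewrite /tensor (bigD1 i)//= [X in _ - X](bigD1 i)//=.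
  have -> : \prod_(j < n | j != i) f j ((h *: unitv R i + x) 0 j) = P.
    by apply: eq_bigr => j ji; rewrite !mxE (negbTE ji) andbF mulr0 add0r.
  by rewrite !mxE !eqxx/= mulr1 -/P mulrBr mulrC [P * f i (x 0 i)]mulrC.
have fl : (fun h => h^-1 *: ((f i \o shift (x 0 i)) (h *: (1:R)) - f i (x 0 i))) @ 0^' --> d.
  by case: fd => dr <-; exact: dr.
have Fl : (fun h => h^-1 *: ((tensor f \o shift x) (h *: unitv R i) - tensor f x)) @ 0^'
    --> P * d.
  by rewrite e; apply: cvgZ fl; exact: cvg_cst.
by apply: DeriveDef; [apply/cvg_ex; exists (P * d)|exact/cvg_lim].
Qed.

(** A partial derivative of a tensor is the tensor with one factor differentiated, so the induction
    stays within tensors. *)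
Lemma Ck_tensor n k (f : 'I_n -> R -> R) : (forall i, Ck1 k (f i)) -> Ck k (tensor f).
Proof.
elim: k f => [|k IH] f fk.
  by split=> //; apply: tensor_continuous => i; exact: fk.
split; first by apply: tensor_continuous => i; exact: Ck1_continuous (fk i).
move=> i; have [f' [fd f'k]] := fk i.
split=> [x|]; first by case: (is_derive_tensor (fd (x 0 i))).
have -> : pderiv i (tensor f) = tensor (fun j => if j == i then f' else f j).
  apply/funext => x; rewrite /pderiv; case: (is_derive_tensor (fd (x 0 i))) => _ ->.
  rewrite [RHS](bigD1 i)//= eqxx mulrC; congr (_ * _).
  by apply: eq_bigr => j /negbTE ->.
by apply: IH => j; case: ifP => // _; exact: Ck1S.
Qed.

Lemma Ck0 n k : Ck k (fun _ : 'rV[R]_n => 0 : R).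
Proof.
elim: k => [|k IH]; first by split=> // x; exact: cst_continuous.
split=> [x|i]; first exact: cst_continuous.
split=> [x|]; first exact: derivable_cst.
by rewrite (_ : pderiv _ _ = fun=> 0)//; apply/funext => x; exact: derive_cst.
Qed.

Lemma smooth_real_pderiv n (h : 'rV[R]_n -> R) i : smooth_real h -> smooth_real (pderiv i h).
Proof. by move=> hs k; have [_ /(_ i) []] := hs k.+1. Qed.

Lemma smooth_real_pderivs n (h : 'rV[R]_n -> R) s : smooth_real h -> smooth_real (pderivs s h).
Proof. by move=> hs; elim: s => //= i s IH; exact: smooth_real_pderiv. Qed.

Definition box n (M : R) : set 'rV[R]_n := [set x | forall i, x 0 i \in `[- M, M]].

Lemma box_compact n M : compact (@box n M).
Proof.
apply: (@rV_compact _ _ (fun=> `[- M, M]%classic)) => _.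
exact: segment_compact.
Qed.

Lemma box_open_compl n M : open (~` @box n M).
Proof. by rewrite openC; apply: compact_closed; [exact: norm_hausdorff|exact: box_compact]. Qed.

Lemma pderivs_eq0 n (h : 'rV[R]_n -> R) M s : (forall x, ~ box M x -> h x = 0) ->
  forall x, ~ box M x -> pderivs s h x = 0.
Proof.
move=> h0; elim: s => //= i s IH x bx; rewrite /pderiv.
rewrite (@near_eq_derive _ _ _ _ (cst 0)) ?derive_cst//.
by near=> y; apply: IH; near: y; apply: open_nbhs_nbhs; split=> //; exact: box_open_compl.
Unshelve. all: by end_near. Qed.

Lemma schwartz_real_compact n (h : 'rV[R]_n -> R) M : smooth_real h ->
  (forall x, ~ box M x -> h x = 0) -> schwartz_real h.
Proof.
move=> hs h0; split=> // al s.
have mc : continuous (fun x => monom al x * pderivs s h x).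
  have c1 : continuous (monom al : 'rV[R]_n -> R).
    apply: (@tensor_continuous n (fun i t => t ^+ al i)) => i t.
    exact: exprn_continuous.
  have c2 : continuous (pderivs s h) by have [] := smooth_real_pderivs s hs 0.
  by move=> x; exact: (continuousM (c1 x) (c2 x)).
have [C [_ hC]] := compact_bounded (continuous_compact
  (continuous_subspaceT mc) (@box_compact n M)).
exists (`|C| + 1) => x; have [bx|bx] := pselect (box M x).
  by apply: (hC (`|C| + 1)); [rewrite (le_lt_trans (ler_norm _))// ltrDl|exists x].
by rewrite (pderivs_eq0 s h0 bx) mulr0 normr0 addr_ge0.
Qed.

Lemma schwartz_real0 n : schwartz_real (fun _ : 'rV[R]_n => 0 : R).
Proof. by apply: (@schwartz_real_compact _ _ 0) => // k; exact: Ck0. Qed.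

Lemma schwartz_real_tensor n (f : 'I_n -> R -> R) M :
  (forall k i, Ck1 k (f i)) -> (forall i t, M < `|t| -> f i t = 0) ->
  schwartz_real (tensor f).
Proof.
move=> fk fM; apply: (@schwartz_real_compact _ _ M) => [k|x bx].
  exact: Ck_tensor.
have [i hi] : exists i, ~ (x 0 i \in `[- M, M]) by apply/existsNP.
rewrite /tensor (bigD1 i)//= fM ?mul0r//.
by rewrite ltNge; apply/negP => h; apply: hi; rewrite in_itv/= -ler_norml.
Qed.

End Tensor.

(** * The convolution kernel *)

Section Kernel1.
Context {R : realType}.
Local Notation RL := (measurableTypeR R).
Local Notation leb := (@lebesgue_measure R).

Lemma restrict_segment (f : R -> R) : (forall t, 1 <= `|t| -> f t = 0) ->
  f \_ `[-1, 1] = f.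
Proof.
move=> f0; apply/funext => t; rewrite patchE; case: ifPn => // /negP h.
rewrite f0// leNgt; apply/negP => t1; apply: h; apply/mem_set => /=.
by rewrite in_itv/= -ler_norml ltW.
Qed.

Lemma integrable_compact_supp (f : R -> R) : continuous f ->
  (forall t, 1 <= `|t| -> f t = 0) -> leb.-integrable setT (EFin \o f).
Proof.
move=> fc f0.
have fi := @continuous_compact_integrable R f `[-1, 1]%classic (@segment_compact R (-1) 1)
  (continuous_subspaceT fc).
have := (@integrable_mkcond _ RL R leb `[-1, 1]%classic (EFin \o f) (measurable_itv _)).1 fi.
by rewrite restrict_EFin (restrict_segment f0).
Qed.

Lemma Rintegral_deriv_compact_supp (F f : R -> R) : continuous f ->
  (forall t : R, is_derive t 1 F (f t)) ->
  (forall t, 1 <= `|t| -> f t = 0) -> (forall t, 1 <= `|t| -> F t = 0) ->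
  \int[leb]_t f t = 0.
Proof.
move=> fc Fd f0 F0.
have Fc := is_derive_continuous Fd.
have := @Rintegral_mkcond _ _ R leb `[-1, 1]%classic f.
rewrite (restrict_segment f0) => <-.
rewrite /Rintegral (@continuous_FTC2 _ f F (-1) 1).
- by rewrite !F0 ?normrN ?normr1//= subrr.
- lra.
- exact: continuous_subspaceT.
- split.
  + by move=> x _; case: (Fd x).
  + exact: cvg_at_right_filter (Fc _).
  + exact: cvg_at_left_filter (Fc _).
- by move=> x _; rewrite derive1E; case: (Fd x).
Qed.

Lemma Rintegral_odd (g : R -> R) : (forall t, g (- t) = - g t) ->
  leb.-integrable setT (EFin \o g) -> \int[leb]_t g t = 0.
Proof.
move=> gN gi; rewrite /Rintegral integralE.
have -> : (\int[leb]_x (fun x => (g x)%:E)^\- x = \int[leb]_x (fun x => (g x)%:E)^\+ x)%E.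
  rewrite -[RHS]ge0_integral_reflect; last by move=> t; exact: funepos_ge0.
  by apply: eq_integral => t _; rewrite funeposE funenegE gN.
have h : (\int[leb]_x (fun x => (g x)%:E)^\+ x)%E \is a fin_num.
  exact: integrable_pos_fin_num.
by rewrite -(fineK h) /= subrr.
Qed.

(** Support in [-1/2, 1/2], so that |y| <= 2 forces |y t| <= 1 where the symbol lives; [+ 0] matches
    [Ck1_affine]. *)
Definition symbol1 (t : R) : R := sbump (2 * t + 0).

Lemma Ck1_symbol1 k : Ck1 k symbol1.
Proof. by apply: Ck1_affine; exact: Ck1_sbump. Qed.

Lemma symbol1_ge0 t : 0 <= symbol1 t. Proof. exact: sbump_ge0. Qed.

Lemma symbol1N t : symbol1 (- t) = symbol1 t.
Proof. by rewrite /symbol1 !addr0 mulrN sbumpN. Qed.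

Lemma symbol1_eq0 t : 1 / 2 <= `|t| -> symbol1 t = 0.
Proof.
move=> t2; apply: sbump_eq0; rewrite addr0 normrM ger0_norm//; lra.
Qed.

Lemma symbol1_eq0_ge1 t : 1 <= `|t| -> symbol1 t = 0.
Proof. move=> t2; apply: symbol1_eq0; lra. Qed.

Lemma continuous_cosM (y : R) : continuous (fun t => cos (y * t)).
Proof.
move=> t; apply: (@continuous_comp _ _ _ (fun t => y * t) (@cos R)).
  exact: mulrl_continuous.
exact: continuous_cos.
Qed.

Lemma continuous_sinM (y : R) : continuous (fun t => sin (y * t)).
Proof.
move=> t; apply: (@continuous_comp _ _ _ (fun t => y * t) (@sin R)).
  exact: mulrl_continuous.
exact: continuous_sin.
Qed.

Definition cos_symbol1 (y t : R) : R := symbol1 t * cos (y * t).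
Definition sin_symbol1 (y t : R) : R := symbol1 t * sin (y * t).

(** The Fourier integral of an even function, whose sine part vanishes; the factor 1/(2 pi) is left
    out. *)
Definition kernel1 (y : R) : R := \int[leb]_t cos_symbol1 y t.

Lemma integrable_symbol1 : leb.-integrable setT (EFin \o symbol1).
Proof.
by apply: integrable_compact_supp symbol1_eq0_ge1; exact: Ck1_continuous (Ck1_symbol1 0).
Qed.

Lemma integrable_cos_symbol1 y : leb.-integrable setT (EFin \o cos_symbol1 y).
Proof.
apply: integrable_compact_supp => [t|t t1]; last by rewrite /cos_symbol1 symbol1_eq0_ge1// mul0r.
exact: (continuousM (Ck1_continuous (Ck1_symbol1 0) (x := t)) (continuous_cosM (x := t))).
Qed.

Lemma integrable_sin_symbol1 y : leb.-integrable setT (EFin \o sin_symbol1 y).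
Proof.
apply: integrable_compact_supp => [t|t t1]; last by rewrite /sin_symbol1 symbol1_eq0_ge1// mul0r.
exact: (continuousM (Ck1_continuous (Ck1_symbol1 0) (x := t)) (continuous_sinM (x := t))).
Qed.

Lemma Rintegral_sin_symbol1 y : \int[leb]_t sin_symbol1 y t = 0.
Proof.
apply: Rintegral_odd; last exact: integrable_sin_symbol1.
by move=> t; rewrite /sin_symbol1 symbol1N mulrN sinN mulrN.
Qed.

(** By continuity the symbol exceeds half its value at 0 on some interval ]-e, e[, and the
    corresponding step function has positive integral. *)
Lemma Rintegral_symbol1_gt0 : 0 < \int[leb]_t symbol1 t.
Proof.
have c0 : continuous symbol1 := Ck1_continuous (Ck1_symbol1 0).
have a0 : 0 < symbol1 0 by apply: sbump_gt0; rewrite mulr0 addr0 normr0.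
have near0 : \forall t \near (0 : R), symbol1 0 / 2 < symbol1 t.
  by apply: (cvgr_gt _ (c0 0)); lra.
have /nbhs_ballP[e /= e0 he] := near0.
pose g (t : R) : R := symbol1 0 / 2 * \1_(`]- e, e[ : set R) t.
have gi : leb.-integrable setT (EFin \o g).
  apply: (eq_integrable measurableT _ _ _
    (integrableZl measurableT (symbol1 0 / 2) (@integrable_indic_itv R (- e) e false true))) => //.
apply: (@lt_le_trans _ _ (\int[leb]_t g t)); last first.
  apply: le_Rintegral => //; first exact: integrable_symbol1.
  move=> t _; rewrite /g indicE; case: (boolP (t \in _)) => [|_].
    rewrite inE /= in_itv/= mulr1 => te; apply/ltW/he.
    by rewrite /ball/= sub0r normrN ltr_norml.
  by rewrite mulr0 symbol1_ge0.
rewrite /g RintegralZl//; last first.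
  exact: (@integrable_indic_itv R (- e) e false true).
apply: mulr_gt0; first lra.
rewrite /Rintegral integral_indic// setIT.
have := @lebesgue_measure_itv R `]- e, e[%R.
by rewrite /= lte_fin ifT -?EFinB; [move=> -> /=|]; lra.
Qed.

Lemma kernel1_norm_le y : `|kernel1 y| <= \int[leb]_t symbol1 t.
Proof.
rewrite (le_trans (le_normr_Rintegral measurableT (integrable_cos_symbol1 y)))//.
apply: le_Rintegral => //; last 2 first.
- exact: integrable_symbol1.
- move=> t _; rewrite normrM ger0_norm ?symbol1_ge0//.
  by rewrite ler_piMr ?symbol1_ge0// ler_norml cos_geN1 cos_le1.
exact: integrable_norm (integrable_cos_symbol1 y).
Qed.

(** On the support of the symbol |y t| <= 1 <= pi, and cos decreases on [0, pi], so the integrand is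
    at least cos 1 times the symbol. *)
Lemma kernel1_ge y : `|y| <= 2 -> cos 1 * (\int[leb]_t symbol1 t) <= kernel1 y.
Proof.
move=> y2; rewrite -RintegralZl//; last exact: integrable_symbol1.
apply: le_Rintegral => //.
- by apply: (eq_integrable measurableT _ _ _ (integrableZl measurableT (cos 1) integrable_symbol1)).
- exact: integrable_cos_symbol1.
move=> t _; rewrite /cos_symbol1; have [t2|t2] := leP (1 / 2) `|t|.
  by rewrite symbol1_eq0// mulr0 mul0r.
rewrite mulrC ler_wpM2l ?symbol1_ge0//.
have -> : cos (y * t) = cos `|y * t|.
  by have [_|_] := ger0P (y * t) => //; rewrite cosN.
have yt1 : `|y * t| <= 1.
  rewrite normrM (@le_trans _ _ (2 * (1 / 2)))//; last lra.
  by apply: ler_pM => //; exact: ltW.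
have pi1 : 1 <= pi :> R by have := @pi_ge2 R; lra.
move: yt1; rewrite le_eqVlt => /predU1P[->//|yt1]; apply: ltW.
rewrite ltr_cos// in_itv/= ?normr_ge0 ?ler01//.
exact: le_trans (ltW yt1) pi1.
Qed.

Lemma kernel1_decay : exists2 C, 0 <= C & forall y, y ^+ 2 * `|kernel1 y| <= C.
Proof.
have [a' [ad [a'' [a'd a''c]]]] := Ck1_symbol1 2.
(* The strict inequality describes an open set, so f vanishes near t and its derivative at t is 0.
   The margin between 1/2 and 1 makes both derivatives vanish for |t| >= 1, in particular at the
   endpoints of integration. *)
have loc (f f' : R -> R) : (forall t : R, is_derive t 1 f (f' t)) ->
    (forall t, 1 / 2 < `|t| -> f t = 0) -> forall t, 1 / 2 < `|t| -> f' t = 0.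
  move=> fd f0 t t1.
  have [_ <-] := fd t.
  rewrite (@near_eq_derive R R R f (cst 0)) ?derive_cst//.
  near=> s; apply: f0; near: s.
  by apply: (@cvgr_gt _ _ _ _ (fun s : R => `|s|)); first exact: norm_continuous.
have a'0 := loc _ _ ad (fun t h => symbol1_eq0 (ltW h)).
have a''0 := loc _ _ a'd a'0.
have ge1 (t : R) : 1 <= `|t| -> 1 / 2 < `|t| by lra.
have a''i : leb.-integrable setT (EFin \o a'').
  by apply: integrable_compact_supp => // t /ge1; exact: a''0.
exists (\int[leb]_t `|a'' t|) => [|y].
  by apply: Rintegral_ge0.
pose g t := a'' t * cos (y * t).
have gc : continuous g.
  by move=> t; exact: (continuousM (a''c t) (continuous_cosM (x := t))).
have gi : leb.-integrable setT (EFin \o g).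
  by apply: integrable_compact_supp => // t /ge1 t1; rewrite /g a''0// mul0r.
have lin (t : R) : is_derive t 1 (fun t : R => y * t) y.
  have := @is_deriveZ _ _ _ id y t 1 1 _; rewrite /GRing.scale /= mulr1; apply.
(* F performs two integrations by parts at once:
   its derivative is y^2 a(t) cos(y t) + a''(t) cos(y t). *)
pose F t := symbol1 t * (y * sin (y * t)) + a' t * cos (y * t).
have Fd (t : R) : is_derive t 1 F (y ^+ 2 * cos_symbol1 y t + g t).
  have h1 := @is_derive1_comp R sin (fun t => y * t) t _ _ (is_derive_sin _) (lin t).
  have h2 := @is_derive1_comp R cos (fun t => y * t) t _ _ (is_derive_cos _) (lin t).
  have h3 := is_deriveD (is_deriveM (ad t) (is_deriveZ y h1)) (is_deriveM (a'd t) h2).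
  apply: is_derive_eq h3 _.
  by rewrite /cos_symbol1 /g /GRing.scale /= -[y *: sin _]/(y * sin _); ring.
have cac : continuous (cos_symbol1 y).
  move=> t; exact: (continuousM (Ck1_continuous (Ck1_symbol1 0) (x := t))
    (continuous_cosM (x := t))).
have y2i : leb.-integrable setT (EFin \o (fun t => y ^+ 2 * cos_symbol1 y t)).
  exact: (eq_integrable measurableT _ _ _
    (integrableZl measurableT (y ^+ 2) (integrable_cos_symbol1 y))).
have := @Rintegral_deriv_compact_supp F _ _ Fd _ _.
rewrite RintegralD// RintegralZl//; last exact: integrable_cos_symbol1.
rewrite -/(kernel1 y) => e.
have {}e : y ^+ 2 * kernel1 y = - \int[leb]_t g t.
  apply/eqP; rewrite -addr_eq0; apply/eqP; apply: e.
  - move=> t; apply: cvgD; last exact: gc.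
    by apply: cvgM; [exact: cvg_cst|exact: cac].
  - move=> t t1; rewrite /cos_symbol1 /g symbol1_eq0_ge1// a''0; last exact: ge1.
    by rewrite !mul0r mulr0 addr0.
  - move=> t t1; rewrite /F symbol1_eq0_ge1// a'0; last exact: ge1.
    by rewrite !mul0r addr0.
rewrite -[X in X * _]ger0_norm ?sqr_ge0// -normrM e normrN.
rewrite (le_trans (le_normr_Rintegral measurableT gi))//.
apply: le_Rintegral => //.
- exact: integrable_norm gi.
- exact: integrable_norm a''i.
- by move=> t _; rewrite normrM ler_piMr// ler_norml cos_geN1 cos_le1.
Unshelve. all: by end_near. Qed.

Definition inv_oneDsqr (t : R) : R := (oneDsqr t)^-1.

Lemma inv_oneDsqr_ge0 t : 0 <= inv_oneDsqr t.
Proof. by rewrite invr_ge0 (le_trans ler01)// oneDsqr_ge1. Qed.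

(** Adding the uniform bound and the bound on y^2 |k(y)| controls (1 + y^2) |k(y)|. *)
Lemma kernel1_le_inv_oneDsqr : exists2 C, 0 <= C & forall y, `|kernel1 y| <= C * inv_oneDsqr y.
Proof.
have [C C0 hC] := kernel1_decay.
exists (\int[leb]_t symbol1 t + C); first by rewrite addr_ge0// ltW// Rintegral_symbol1_gt0.
move=> y; rewrite ler_pdivlMr; last by rewrite (lt_le_trans ltr01)// oneDsqr_ge1.
rewrite /oneDsqr mulrDr mulr1 lerD ?kernel1_norm_le//.
by rewrite mulrC hC.
Qed.

Lemma integrable_inv_oneDsqr : leb.-integrable setT (EFin \o inv_oneDsqr).
Proof.
have qc : continuous inv_oneDsqr by exact: continuous_oneDsqrV.
apply/integrableP; split.
  by apply/measurable_EFinP; exact: continuous_measurable_fun.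
under eq_integral => t _ do rewrite /= ger0_norm ?inv_oneDsqr_ge0//.
rewrite ge0_symfun_integralT//; last 2 first.
- exact: inv_oneDsqr_ge0.
- by move=> t; rewrite /inv_oneDsqr /oneDsqr /= sqrrN.
by rewrite -set_itvcy integral0y_oneDsqr// -EFinM ltry.
Qed.

Definition inv_oneDsqr_total : R := \int[leb]_t inv_oneDsqr t.

Lemma Rintegral_inv_oneDsqr_translate (x : R) :
  leb.-integrable setT (EFin \o (fun t => inv_oneDsqr (x - t))) /\
  \int[leb]_t inv_oneDsqr (x - t) = inv_oneDsqr_total.
Proof.
have e : (\int[leb]_t (inv_oneDsqr (x - t))%:E = \int[leb]_t (inv_oneDsqr t)%:E)%E.
  have q0 t : (0 <= (inv_oneDsqr t)%:E)%E by rewrite lee_fin inv_oneDsqr_ge0.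
  rewrite -[RHS](@ge0_integral_translate _ (- x))//.
  apply: eq_integral => t _; congr EFin.
  by rewrite /inv_oneDsqr /oneDsqr -sqrrN opprB.
split; last by rewrite /inv_oneDsqr_total /Rintegral e.
apply/integrableP; split.
  apply/measurable_EFinP; apply: continuous_measurable_fun => t.
  apply: (@continuous_comp _ _ _ (fun t => x - t) inv_oneDsqr).
    by apply: cvgB; [exact: cvg_cst|exact: cvg_id].
  exact: continuous_oneDsqrV.
under eq_integral => t _ do rewrite /= ger0_norm ?inv_oneDsqr_ge0//.
rewrite e; have /integrableP[_] := integrable_inv_oneDsqr.
by under eq_integral => t _ do rewrite /= ger0_norm ?inv_oneDsqr_ge0//.
Qed.

End Kernel1.

(** * The kernel in n variables and convolution with it *)

Section KernelN.
Context {R : realType}.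
Local Notation RL := (measurableTypeR R).
Local Notation leb := (@lebesgue_measure R).

Lemma EFin_Rintegral d (T : measurableType d) (mu : {measure set T -> \bar R}) (f : T -> R) :
  mu.-integrable setT (EFin \o f) ->
  (\int[mu]_x (f x)%:E)%E = (\int[mu]_x f x)%:E.
Proof. by move=> fi; rewrite /Rintegral fineK//; exact: integrable_fin_num. Qed.

Lemma integrable_measurable d (T : measurableType d) (mu : {measure set T -> \bar R})
  (f : T -> R) : mu.-integrable setT (EFin \o f) -> measurable_fun setT f.
Proof. by move=> fi; apply/measurable_EFinP; exact: measurable_int fi. Qed.

Lemma integrableMbound d (T : measurableType d) (mu : {measure set T -> \bar R})
  (f g : T -> R) (C : R) : mu.-integrable setT (EFin \o f) ->
  measurable_fun setT (fun x => f x * g x) -> (forall x, `|g x| <= C) ->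
  mu.-integrable setT (EFin \o (fun x => f x * g x)).
Proof.
move=> fi mfg gC.
apply: (@le_integrable _ _ _ mu setT measurableT _ (fun x => C%:E * (f x)%:E)%E).
- exact/measurable_EFinP.
- move=> x _; rewrite /= lee_fin !normrM mulrC ler_wpM2r//.
  by rewrite (le_trans (gC x))// ler_norm.
- exact: integrableZl.
Qed.

Definition symbol n (xi : 'rV[R]_n) : R := tensor (fun=> symbol1) xi.
(** This is (2 pi)^n times the inverse Fourier transform of [symbol]; the normalisation reappears in
    [fmult_convolution]. *)
Definition kernel n (y : 'rV[R]_n) : R := tensor (fun=> kernel1) y.

Lemma dotRn_vcons n (y : 'rV[R]_n.+1) t (x : 'rV[R]_n) :
  dotRn y (vcons t x) = y 0 ord0 * t + dotRn (vtail y) x.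
Proof.
rewrite /dotRn big_ord_recl vcons0; congr (_ + _).
by apply: eq_bigr => i _; rewrite vconsS mxE.
Qed.

(** Splitting off one variable by the addition formulas mixes cosine and sine, so both integrals go
    through the induction together; every term containing a sine integral vanishes. *)
Lemma integral_symbol_trig n (y : 'rV[R]_n) :
  [/\ (lebn n).-integrable setT (EFin \o (fun xi => symbol xi * cos (dotRn y xi))),
      \int[lebn n]_xi (symbol xi * cos (dotRn y xi)) = kernel y,
      (lebn n).-integrable setT (EFin \o (fun xi => symbol xi * sin (dotRn y xi))) &
      \int[lebn n]_xi (symbol xi * sin (dotRn y xi)) = 0].
Proof.
elim: n y => [|n IH] y.
  have [i1 ->] := integral_lebn_dim0 (fun xi : Rn R 0 => symbol xi * cos (dotRn y xi)).
  have [i2 ->] := integral_lebn_dim0 (fun xi : Rn R 0 => symbol xi * sin (dotRn y xi)).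
  split=> //; rewrite /symbol /kernel /tensor /dotRn !big_ord0 ?cos0 ?sin0 ?mulr1//.
  by rewrite mulr0.
have [ci cE si sE] := IH (vtail y).
pose f1 := cos_symbol1 (y 0 ord0); pose f2 := sin_symbol1 (y 0 ord0).
have f1i : leb.-integrable setT (EFin \o f1) := integrable_cos_symbol1 _.
have f2i : leb.-integrable setT (EFin \o f2) := integrable_sin_symbol1 _.
set g1 := (fun xi : 'rV[R]_n => _) in ci; set g2 := (fun xi : 'rV[R]_n => _) in si.
pose F (f : R -> R) (g : 'rV[R]_n -> R) (x : 'rV[R]_n.+1) := f (x 0 ord0) * g (vtail x).
have FE f g t x : F f g (vcons t x) = f t * g x by rewrite /F vcons0 vconsK.
have [i11 e11] := integrable_head_tail f1i ci (FE f1 g1).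
have [i12 e12] := integrable_head_tail f1i si (FE f1 g2).
have [i21 e21] := integrable_head_tail f2i ci (FE f2 g1).
have [i22 e22] := integrable_head_tail f2i si (FE f2 g2).
have cosE : (fun xi : 'rV[R]_n.+1 => symbol xi * cos (dotRn y xi)) =
    (fun x => F f1 g1 x - F f2 g2 x).
  apply/funext => x; rewrite -(vcons_tail x) !FE /symbol tensor_vcons dotRn_vcons cosD.
  by rewrite /f1 /f2 /g1 /g2 /cos_symbol1 /sin_symbol1 /symbol; ring.
have sinE : (fun xi : 'rV[R]_n.+1 => symbol xi * sin (dotRn y xi)) =
    (fun x => F f2 g1 x + F f1 g2 x).
  apply/funext => x; rewrite -(vcons_tail x) !FE /symbol tensor_vcons dotRn_vcons sinD.
  by rewrite /f1 /f2 /g1 /g2 /cos_symbol1 /sin_symbol1 /symbol; ring.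
rewrite cosE sinE; split.
- exact: (eq_integrable measurableT _ _ _ (integrableB measurableT i11 i22)).
- rewrite RintegralB// e11 e22 /g1 /g2 sE cE mulr0 subr0 /kernel /tensor big_ord_recl.
  by congr (_ * _); apply: eq_bigr => i _; rewrite mxE.
- exact: (eq_integrable measurableT _ _ _ (integrableD measurableT i21 i12)).
- by rewrite RintegralD// e12 e21 /g2 sE mulr0 /f2 Rintegral_sin_symbol1 mul0r addr0.
Qed.

Lemma integrable_symbol n : (lebn n).-integrable setT (EFin \o @symbol n).
Proof. by have [] := @integrable_tensor R n (fun=> symbol1) (fun=> integrable_symbol1). Qed.

Lemma kernel_bound n : exists2 C, 0 <= C &
  forall y : 'rV[R]_n, `|kernel y| <= \prod_i (C * inv_oneDsqr (y 0 i)).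
Proof.
have [C C0 hC] := @kernel1_le_inv_oneDsqr R; exists C => // y.
by rewrite /kernel /tensor normr_prod; apply: ler_prod => i _; rewrite normr_ge0 hC.
Qed.

Lemma kernel_bounded n : exists C, forall y : 'rV[R]_n, `|kernel y| <= C.
Proof.
have [C C0 hC] := kernel_bound n; exists (\prod_(i < n) C) => y.
rewrite (le_trans (hC y))//; apply: ler_prod => i _.
rewrite mulr_ge0 ?inv_oneDsqr_ge0//= ler_piMr//.
by rewrite /inv_oneDsqr invf_le1 ?oneDsqr_ge1// (lt_le_trans ltr01)// oneDsqr_ge1.
Qed.

Lemma measurable_dot_pair n (x : 'rV[R]_n) :
  measurable_fun [set: Rn R n * Rn R n] (fun p => dotRn (x - p.2) p.1).
Proof.
rewrite /dotRn; apply: measurable_sum => i.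
under eq_fun do rewrite mxE [X in x 0 i + X]mxE.
apply: measurable_funM.
  apply: measurable_funB; first exact: measurable_cst.
  exact: (measurableT_comp (measurable_coord i) measurable_snd).
exact: (measurableT_comp (measurable_coord i) measurable_fst).
Qed.

(** Fubini, with dominating function |symbol(xi)| (|V(z)| + |W(z)|): the inner integral in xi turns
    the cosine into [kernel (x - z)] and kills the sine, hence W. The form with two functions covers
    both the real and the imaginary part of the multiplier operator. *)
Lemma convolution_formula n (V W : Rn R n -> R) (x : 'rV[R]_n) :
  (lebn n).-integrable setT (EFin \o V) -> (lebn n).-integrable setT (EFin \o W) ->
  let P xi := \int[lebn n]_z (V z * cos (dotRn (x - z) xi) + W z * sin (dotRn (x - z) xi)) in
  [/\ measurable_fun [set: Rn R n] (fun xi => symbol xi * P xi),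
      (lebn n).-integrable setT (EFin \o (fun z => V z * kernel (x - z))) &
      \int[lebn n]_xi (symbol xi * P xi) = \int[lebn n]_z (V z * kernel (x - z))].
Proof.
move=> Vi Wi P.
have mV := integrable_measurable Vi; have mW := integrable_measurable Wi.
have mA := integrable_measurable (integrable_symbol n).
pose h (p : Rn R n * Rn R n) : R :=
  V p.2 * cos (dotRn (x - p.2) p.1) + W p.2 * sin (dotRn (x - p.2) p.1).
have mh : measurable_fun setT h.
  apply: measurable_funD; apply: measurable_funM.
  - exact: (measurableT_comp mV measurable_snd).
  - apply: (measurableT_comp _ (measurable_dot_pair x)).
    exact: continuous_measurable_fun (@continuous_cos R).
  - exact: (measurableT_comp mW measurable_snd).
  - apply: (measurableT_comp _ (measurable_dot_pair x)).
    exact: continuous_measurable_fun (@continuous_sin R).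
have hle p : `|h p| <= `|V p.2| + `|W p.2|.
  rewrite (le_trans (ler_normD _ _))// !normrM lerD// ler_piMr// ler_norml.
    by rewrite cos_geN1 cos_le1.
  by rewrite sin_geN1 sin_le1.
have VWi : (lebn n).-integrable setT (EFin \o (fun z => `|V z| + `|W z|)).
  exact: (eq_integrable measurableT _ _ _
    (integrableD measurableT (integrable_norm Vi) (integrable_norm Wi))).
pose f (p : Rn R n * Rn R n) := symbol p.1 * h p.
have mf : measurable_fun setT f.
  apply: measurable_funM => //; exact: (measurableT_comp mA measurable_fst).
have [fdom _] := integrable_prodfun (integrable_symbol n) VWi.
have fi : (product_measure1 (lebn n) (lebn n)).-integrable setT (EFin \o f).
  apply: (le_integrable measurableT _ _ fdom); first exact/measurable_EFinP.
  move=> p _; rewrite /= lee_fin /f !normrM ler_wpM2l// (le_trans (hle p))//.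
  by rewrite ler_norm.
have hi xi : (lebn n).-integrable setT (EFin \o (fun z => h (xi, z))).
  apply: (le_integrable measurableT _ _ VWi).
    apply/measurable_EFinP; exact: (measurableT_comp mh (measurable_pair1 xi)).
  by move=> z _; rewrite /= lee_fin (le_trans (hle _))// ler_norm.
have FE xi : (\int[lebn n]_z (f (xi, z))%:E = (symbol xi * P xi)%:E)%E.
  rewrite /f /=; under eq_integral do rewrite EFinM.
  rewrite integralZl//; last exact: hi.
  by rewrite (EFin_Rintegral (hi xi)).
have GE z : (\int[lebn n]_xi (f (xi, z))%:E = (V z * kernel (x - z))%:E)%E.
  have [ci cE si sE] := integral_symbol_trig (x - z).
  have c1 := integrableZl measurableT (V z) ci.
  have s1 := integrableZl measurableT (W z) si.
  have -> : (\int[lebn n]_xi (f (xi, z))%:E = \int[lebn n]_xi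
      ((V z)%:E * (symbol xi * cos (dotRn (x - z) xi))%:E +
       (W z)%:E * (symbol xi * sin (dotRn (x - z) xi))%:E))%E.
    apply: eq_integral => xi _; rewrite -!EFinM -EFinD; congr EFin.
    by rewrite /f /h /=; ring.
  rewrite integralD// !integralZl// (EFin_Rintegral ci) (EFin_Rintegral si) cE sE.
  by rewrite mule0 adde0.
(* Both measurability claims are read off from the Fubini marginals, through [FE] and [GE]. *)
have mG := measurable_fubini_G fi; have mF := measurable_fubini_F fi.
have mVK : measurable_fun [set: Rn R n] (fun z => V z * kernel (x - z)).
  apply/measurable_EFinP; apply: eq_measurable_fun mG => z _.
  exact: GE.
have [C KC] := kernel_bounded n.
split.
- apply/measurable_EFinP; apply: eq_measurable_fun mF => xi _.
  exact: FE.
- exact: (integrableMbound Vi mVK (fun z => KC _)).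
- rewrite /Rintegral; congr fine.
  rewrite -(eq_integral _ _ (fun xi _ => FE xi)) -(eq_integral _ _ (fun z _ => GE z)).
  exact: (Fubini fi).
Qed.

(** Young's inequality L^oo * L^1, with C the integral of the product majorant of the kernel;
    translating that majorant by x leaves its integral unchanged. *)
Lemma convolution_bound n : exists2 C, 0 <= C & forall (V : Rn R n -> R) (x : 'rV[R]_n) M,
  (lebn n).-integrable setT (EFin \o V) -> 0 <= M -> (forall z, `|V z| <= M) ->
  `|\int[lebn n]_z (V z * kernel (x - z))| <= C * M.
Proof.
have [Ck Ck0 hK] := kernel_bound n.
have q0 : 0 <= @inv_oneDsqr_total R by apply: Rintegral_ge0 => t _; exact: inv_oneDsqr_ge0.
exists (\prod_(i < n) (Ck * @inv_oneDsqr_total R)).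
  by apply: prodr_ge0 => i _; rewrite mulr_ge0.
move=> V x M Vi M0 VM.
(* Only integrability of the product is wanted here, so V also fills the place of W. *)
have [_ VKi _] := convolution_formula x Vi Vi.
pose g i t : R := Ck * inv_oneDsqr (x 0 i - t).
have gi i : leb.-integrable setT (EFin \o g i).
  have [qi _] := Rintegral_inv_oneDsqr_translate (x 0 i).
  exact: (eq_integrable measurableT _ _ _ (integrableZl measurableT Ck qi)).
have [Gi Ge] := integrable_tensor gi.
rewrite (le_trans (le_normr_Rintegral measurableT VKi))//.
have -> : \prod_(i < n) (Ck * @inv_oneDsqr_total R) = \int[lebn n]_z tensor g z.
  rewrite Ge; apply: eq_bigr => i _.
  have [qi qE] := Rintegral_inv_oneDsqr_translate (x 0 i).
  by rewrite RintegralZl// qE.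
rewrite -RintegralZr//; apply: le_Rintegral => //.
- exact: integrable_norm VKi.
- exact: (eq_integrable measurableT _ _ _ (integrableZr measurableT M Gi)).
move=> z _; rewrite normrM mulrC ler_pM//.
rewrite (le_trans (hK _))//; apply: ler_prod => i _.
by rewrite mulr_ge0 ?inv_oneDsqr_ge0//= /g !mxE.
Qed.

(** Wherever V is nonzero, every coordinate of y - z is at most 2 in absolute value, so each factor
    of the kernel is at least c1 = cos 1 times the integral of the symbol; c is the n-th power of
    c1. *)
Lemma convolution_lower n : exists2 c, 0 < c & forall (V : Rn R n -> R) (y : 'rV[R]_n),
  (lebn n).-integrable setT (EFin \o V) -> (forall z, 0 <= V z) ->
  (forall z, V z != 0 -> forall i, `|y 0 i - z 0 i| <= 2) ->
  c * \int[lebn n]_z V z <= \int[lebn n]_z (V z * kernel (y - z)).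
Proof.
pose c1 : R := cos 1 * \int[leb]_t symbol1 t.
have c10 : 0 < c1 by rewrite mulr_gt0 ?cos1_gt0 ?Rintegral_symbol1_gt0.
exists (\prod_(i < n) c1); first by apply: prodr_gt0.
move=> V y Vi V0 hV.
have [_ VKi _] := convolution_formula y Vi Vi.
rewrite -RintegralZl//; apply: le_Rintegral => //.
  exact: (eq_integrable measurableT _ _ _ (integrableZl measurableT _ Vi)).
move=> z _; have [->|Vz] := eqVneq (V z) 0; first by rewrite mulr0 mul0r.
rewrite mulrC ler_wpM2l//; apply: ler_prod => i _.
by rewrite (ltW c10)/= /c1 kernel1_ge// !mxE; exact: hV.
Qed.

Lemma integrable_schwartz n (h : Rn R n -> R) : schwartz_real h ->
  (lebn n).-integrable setT (EFin \o h).
Proof.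
move=> [hs hd].
have mh : measurable_fun [set: Rn R n] h.
  by apply: continuous_Rn_measurable; have [] := hs 0.
(* The product of the 1 + x_i^2 expands into monomials, each of which is bounded
   against h. *)
have /choice[C hC] : forall f : {ffun 'I_n -> bool},
    exists C, forall x : 'rV[R]_n, `|monom (fun i => (f i).*2) x * h x| <= C.
  by move=> f; exact: (hd _ [::]).
have [qi _] := @integrable_tensor R n (fun=> @inv_oneDsqr R) (fun=> integrable_inv_oneDsqr).
apply: (le_integrable measurableT _ _
  (integrableZl measurableT (\sum_f C f) qi)); first exact/measurable_EFinP.
move=> x _; rewrite /= lee_fin; apply: le_trans (ler_norm _).
have oD t : 0 < @oneDsqr R t by rewrite (lt_le_trans ltr01)// oneDsqr_ge1.
have -> : tensor (fun _ : 'I_n => @inv_oneDsqr R) x = (\prod_i oneDsqr (x 0 i))^-1.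
  by rewrite /tensor /inv_oneDsqr prodfV.
rewrite ler_pdivlMr; last exact: prodr_gt0.
rewrite -[X in _ * X]ger0_norm; last by apply: prodr_ge0 => i _; exact: ltW.
rewrite -normrM.
have -> : \prod_i oneDsqr (x 0 i) = \sum_(f : {ffun 'I_n -> bool}) monom (fun i => (f i).*2) x.
  rewrite -(bigA_distr_bigA (fun i (b : bool) => x 0 i ^+ b.*2)).
  by apply: eq_bigr => i _; rewrite big_bool /= addrC expr0.
rewrite mulr_sumr (le_trans (ler_norm_sum _ _ _))//.
by apply: ler_sum => f _; rewrite mulrC.
Qed.

End KernelN.

(** * The multiplier as a convolution operator *)

Section Multiplier.
Context {R : realType}.

Definition csymbol n (xi : 'rV[R]_n) : R[i] := Complex (symbol xi) 0.

Lemma Re_complexM (z w : R[i]) :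
  complex.Re (z * w) = complex.Re z * complex.Re w - complex.Im z * complex.Im w.
Proof. by case: z; case: w. Qed.

Lemma Im_complexM (z w : R[i]) :
  complex.Im (z * w) = complex.Re z * complex.Im w + complex.Im z * complex.Re w.
Proof. by case: z => a b; case: w => c d /=; rewrite [b * c]mulrC. Qed.

Lemma measurable_dot n (xi : 'rV[R]_n) : measurable_fun [set: Rn R n] (fun z => dotRn z xi).
Proof.
rewrite /dotRn; apply: measurable_sum => i.
by apply: measurable_funM; [exact: measurable_coord|exact: measurable_cst].
Qed.

Lemma integrable_trig n (V : Rn R n -> R) (xi : 'rV[R]_n) :
  (lebn n).-integrable setT (EFin \o V) ->
  (lebn n).-integrable setT (EFin \o (fun z => V z * cos (dotRn z xi))) /\
  (lebn n).-integrable setT (EFin \o (fun z => V z * sin (dotRn z xi))).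
Proof.
move=> Vi; have mV := integrable_measurable Vi.
split.
  apply: (@integrableMbound _ _ _ _ V (fun z => cos (dotRn z xi)) 1 Vi) => [|z].
    apply: measurable_funM => //; apply: (measurableT_comp _ (measurable_dot xi)).
    exact: continuous_measurable_fun (@continuous_cos R).
  by rewrite ler_norml cos_geN1 cos_le1.
apply: (@integrableMbound _ _ _ _ V (fun z => sin (dotRn z xi)) 1 Vi) => [|z].
  apply: measurable_funM => //; apply: (measurableT_comp _ (measurable_dot xi)).
  exact: continuous_measurable_fun (@continuous_sin R).
by rewrite ler_norml sin_geN1 sin_le1.
Qed.

Lemma dotRnBl n (x z xi : 'rV[R]_n) : dotRn (x - z) xi = dotRn x xi - dotRn z xi.
Proof.
by rewrite /dotRn -sumrB; apply: eq_bigr => i _; rewrite !mxE mulrBl.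
Qed.

(** With the Fourier transform of u written P + i Q, multiplication by e^(i x xi) and the angle
    difference formulas give the integrand of [convolution_formula], for the pair (U1, - U2) in the
    real part and (U2, U1) in the imaginary part. *)
Lemma fmult_convolution n (u : 'rV[R]_n -> R[i]) (x : 'rV[R]_n)
    (U1 := fun z => complex.Re (u z)) (U2 := fun z => complex.Im (u z)) :
  (lebn n).-integrable setT (EFin \o U1) -> (lebn n).-integrable setT (EFin \o U2) ->
  fmult (@csymbol n) u x =
    Complex ((2 * pi) ^- n * \int[lebn n]_z (U1 z * kernel (x - z)))
            ((2 * pi) ^- n * \int[lebn n]_z (U2 z * kernel (x - z))).
Proof.
move=> i1 i2.
pose P xi := \int[lebn n]_z (U1 z * cos (dotRn z xi) + U2 z * sin (dotRn z xi)).
pose Q xi := \int[lebn n]_z (U2 z * cos (dotRn z xi) - U1 z * sin (dotRn z xi)).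
have mR (V W : Rn R n -> R) (xi : 'rV[R]_n) : (lebn n).-integrable setT (EFin \o V) ->
    (lebn n).-integrable setT (EFin \o W) ->
    (lebn n).-integrable setT
      (EFin \o (fun z => V z * cos (dotRn z xi) + W z * sin (dotRn z xi))) /\
    (lebn n).-integrable setT
      (EFin \o (fun z => V z * cos (dotRn z xi) - W z * sin (dotRn z xi))).
  move=> Vi Wi; have [Vc _] := integrable_trig xi Vi; have [_ Ws] := integrable_trig xi Wi.
  split.
    exact: (eq_integrable measurableT _ _ _ (integrableD measurableT Vc Ws)).
  exact: (eq_integrable measurableT _ _ _ (integrableB measurableT Vc Ws)).
have Fu xi : fourier u xi = Complex (P xi) (Q xi).
  have [Pi _] := mR _ _ xi i1 i2; have [_ Qi] := mR _ _ xi i2 i1.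
  rewrite /fourier /Rn_int_c; congr Complex.
    rewrite (_ : (fun _ => _) = (fun z => U1 z * cos (dotRn z xi) + U2 z * sin (dotRn z xi))).
      by apply: Rn_int_realE; exact: integrable_measurable Pi.
    by apply/funext => z; rewrite Re_complexM /= cosN sinN mulrN opprK.
  rewrite (_ : (fun _ => _) = (fun z => U2 z * cos (dotRn z xi) - U1 z * sin (dotRn z xi))).
    by apply: Rn_int_realE; exact: integrable_measurable Qi.
  by apply/funext => z; rewrite Im_complexM /= cosN sinN mulrN addrC.
pose C V W xi := \int[lebn n]_z (V z * cos (dotRn (x - z) xi) + W z * sin (dotRn (x - z) xi)).
have ReE xi : P xi * cos (dotRn x xi) - Q xi * sin (dotRn x xi) =
    C U1 (fun z => - U2 z) xi.
  have [Pi _] := mR _ _ xi i1 i2; have [_ Qi] := mR _ _ xi i2 i1.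
  rewrite /P /Q -!RintegralZr// -RintegralB//; last 2 first.
  - exact: (eq_integrable measurableT _ _ _ (integrableZr measurableT _ Pi)).
  - exact: (eq_integrable measurableT _ _ _ (integrableZr measurableT _ Qi)).
  by apply: eq_Rintegral => z _; rewrite dotRnBl cosB sinB; ring.
have ImE xi : P xi * sin (dotRn x xi) + Q xi * cos (dotRn x xi) = C U2 U1 xi.
  have [Pi _] := mR _ _ xi i1 i2; have [_ Qi] := mR _ _ xi i2 i1.
  rewrite /P /Q -!RintegralZr// -RintegralD//; last 2 first.
  - exact: (eq_integrable measurableT _ _ _ (integrableZr measurableT _ Pi)).
  - exact: (eq_integrable measurableT _ _ _ (integrableZr measurableT _ Qi)).
  by apply: eq_Rintegral => z _; rewrite dotRnBl cosB sinB; ring.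
have i2N : (lebn n).-integrable setT (EFin \o (fun z : Rn R n => - U2 z)).
  exact: (integrableN i2).
have [m1 _ e1] := convolution_formula x i1 i2N.
have [m2 _ e2] := convolution_formula x i2 i1.
rewrite /fmult /inv_fourier /Rn_int_c.
rewrite (_ : (fun xi => complex.Re _) =
  (fun xi => symbol xi * C U1 (fun z => - U2 z) xi)); last first.
  by apply/funext => xi; rewrite Fu Re_complexM Re_complexM Im_complexM /= -ReE; ring.
rewrite (_ : (fun xi => complex.Im _) = (fun xi => symbol xi * C U2 U1 xi)); last first.
  by apply/funext => xi; rewrite Fu Im_complexM Re_complexM Im_complexM /= -ImE; ring.
rewrite !Rn_int_realE// e1 e2.
by apply/eqP; rewrite eq_complex Re_complexM Im_complexM /= !mul0r subr0 addr0 !eqxx.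
Qed.

Lemma schwartz_csymbol n : schwartz (@csymbol n).
Proof.
split; last exact: schwartz_real0.
apply: (@schwartz_real_tensor _ _ _ 1) => [k _|_ t t1]; first exact: Ck1_symbol1.
by rewrite symbol1_eq0_ge1// ltW.
Qed.

Lemma cabs_ge_Re (z : R[i]) : `|complex.Re z| <= cabs z.
Proof. by rewrite /cabs -sqrtr_sqr ler_wsqrtr// lerDl sqr_ge0. Qed.

Lemma cabs_ge_Im (z : R[i]) : `|complex.Im z| <= cabs z.
Proof. by rewrite /cabs -sqrtr_sqr ler_wsqrtr// lerDr sqr_ge0. Qed.

Lemma cabs_ge0 (z : R[i]) : 0 <= cabs z.
Proof. exact: sqrtr_ge0. Qed.

Lemma cabs_le_ReIm (z : R[i]) : cabs z <= `|complex.Re z| + `|complex.Im z|.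
Proof.
rewrite /cabs -[leRHS]ger0_norm ?addr_ge0// -sqrtr_sqr ler_wsqrtr//.
rewrite sqrrD !real_normK ?num_real// -addrA [X in _ <= _ + X]addrC addrA lerDl.
by rewrite mulrn_wge0// mulr_ge0.
Qed.

Lemma cabs_real (a : R) : cabs (Complex a 0) = `|a|.
Proof. by rewrite /cabs /= expr0n/= addr0 sqrtr_sqr. Qed.

Lemma smooth_cabs_continuous n (u : 'rV[R]_n -> R[i]) :
  smooth u -> continuous (fun x => cabs (u x)).
Proof.
move=> [/(_ 0) [c1 _] /(_ 0) [c2 _]] x.
have c3 : continuous (fun x => complex.Re (u x) ^+ 2 + complex.Im (u x) ^+ 2).
  move=> y; apply: (@continuousD _ _ _ (fun x => complex.Re (u x) ^+ 2)).
    exact: (continuousM (c1 y) (c1 y)).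
  exact: (continuousM (c2 y) (c2 y)).
exact: (continuous_comp (c3 x) (@sqrt_continuous R _)).
Qed.

End Multiplier.

(** * Cubes, positivity on open sets, and bounds for integrals *)

Section OpenSets.
Context {R : realType}.
Local Notation RL := (measurableTypeR R).
Local Notation leb := (@lebesgue_measure R).

(** The indicator of an open cube, written as a tensor so that [integrable_tensor] gives its
    integral as a product of lengths. *)
Definition box_indic n (x : 'rV[R]_n) (r : R) : 'rV[R]_n -> R :=
  tensor (fun i => \1_(`]x 0 i - r, x 0 i + r[%classic : set R)).

Lemma box_indic_integrable n (x : 'rV[R]_n) r : 0 < r ->
  (lebn n).-integrable setT (EFin \o box_indic x r) /\
  0 < \int[lebn n]_z box_indic x r z.
Proof.
move=> r0.
have [|? ->] := @integrable_tensor R n (fun i => \1_(`]x 0 i - r, x 0 i + r[%classic : set R)).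
  by move=> i; exact: integrable_indic_itv.
split=> //; apply: prodr_gt0 => i _; rewrite /Rintegral integral_indic// setIT.
have := @lebesgue_measure_itv R `]x 0 i - r, x 0 i + r[%R.
by rewrite /= lte_fin ifT -?EFinB; [move=> -> /=|]; lra.
Qed.

Lemma box_indic_ge0 n (x : 'rV[R]_n) r z : 0 <= box_indic x r z.
Proof. by apply: prodr_ge0 => i _; rewrite indicE. Qed.

Lemma box_indic_le n (x : 'rV[R]_n) r (h : 'rV[R]_n -> R) (c : R) : 0 < r -> 0 <= c ->
  (forall z, 0 <= h z) -> (forall z, ball x r z -> c <= h z) ->
  forall z, c * box_indic x r z <= h z.
Proof.
move=> r0 c0 h0 hc z; rewrite /box_indic /tensor.
have [hz|] := pselect (ball x r z).
  rewrite (le_trans _ (hc z hz))// -[leRHS]mulr1 ler_wpM2l//.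
  by apply: prodr_ile1 => i _; rewrite indicE ler0n lern1 leq_b1.
move=> nz; have [i hi] : exists i, ~ (`|x 0 i - z 0 i| < r).
  by apply/existsNP => hx; apply: nz; apply/ball_rVP.
rewrite (bigD1 i)//= indicE memNset ?mul0r ?mulr0//= in_itv/= => hx; apply: hi.
by rewrite distrC ltr_distl.
Qed.

(** A nonempty open set contains a cube, whose indicator has positive integral and lies below that
    of any Borel set covering it. *)
Lemma Rn_null_open n (V : set 'rV[R]_n) : open V -> V !=set0 -> ~ Rn_null V.
Proof.
move=> oV [x Vx] [N [mN VN N0]].
have /nbhs_ballP[r /= r0 rV] := open_nbhs_nbhs (conj oV Vx).
have [bi b0] := box_indic_integrable x r0.
have : (Rn_int (fun z => (box_indic x r z)%:E) <= Rn_meas N)%E.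
  apply: Rn_int_mono => z; rewrite lee_fin ?box_indic_ge0//.
  rewrite -[leLHS]mul1r; apply: box_indic_le => // y /rV/VN Ny.
  by rewrite indicE mem_set.
rewrite N0 Rn_intE.
- by rewrite (EFin_Rintegral bi) lee_fin leNgt b0.
- exact: measurable_int bi.
- by move=> z; rewrite lee_fin box_indic_ge0.
Qed.

Lemma Rintegral_continuous_gt0 n (h : Rn R n -> R) (x : 'rV[R]_n) :
  continuous (h : 'rV[R]_n -> R) -> (forall z, 0 <= h z) ->
  (lebn n).-integrable setT (EFin \o h) -> 0 < h x -> 0 < \int[lebn n]_z h z.
Proof.
move=> hc h0 hi hx.
have near0 : \forall z \near (x : 'rV[R]_n), h x / 2 < h z.
  by apply: (cvgr_gt _ (hc x)); lra.
have /nbhs_ballP[r /= r0 rh] := near0.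
have [bi b0] := box_indic_integrable x r0.
apply: (@lt_le_trans _ _ (\int[lebn n]_z (h x / 2 * box_indic x r z))).
  by rewrite RintegralZl// mulr_gt0// divr_gt0.
apply: le_Rintegral => //.
  exact: (eq_integrable measurableT _ _ _ (integrableZl measurableT _ bi)).
move=> z _; apply: box_indic_le => //; first by rewrite divr_ge0// ltW.
by move=> y /rh; exact: ltW.
Qed.

Lemma Rn_meas_unit_cube n (G : set 'rV[R]_n) : G `<=` @unit_cube R n ->
  (Rn_meas G < +oo)%E.
Proof.
move=> GU; have r2 : 0 < 2 :> R by [].
have [bi _] := box_indic_integrable (0 : 'rV[R]_n) r2.
apply: (@le_lt_trans _ _ (Rn_int (fun z => (box_indic 0 2 z)%:E))).
  apply: Rn_int_mono => z; rewrite lee_fin indicE//.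
  case: (boolP (z \in G)) => [/set_mem/GU Gz|_]; last exact: box_indic_ge0.
  rewrite /box_indic /tensor big1// => i _; rewrite indicE mem_set//= in_itv/= mxE.
  by have := Gz i; lra.
rewrite Rn_intE.
- by rewrite (EFin_Rintegral bi) ltry.
- exact: measurable_int bi.
- by move=> z; rewrite lee_fin box_indic_ge0.
Qed.

Lemma Rn_int_scale_indic n (A : set 'rV[R]_n) (c : R) : borel_set A -> 0 <= c ->
  Rn_int (fun x => (c * \1_A x)%:E) = (c%:E * Rn_meas A)%E.
Proof.
move=> mA c0.
have mI : measurable_fun [set: Rn R n] (\1_A : Rn R n -> R) by exact: measurable_indic.
rewrite /Rn_meas !Rn_intE//.
- by under eq_integral do rewrite EFinM; rewrite ge0_integralZl//; exact/measurable_EFinP.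
- exact/measurable_EFinP.
- by apply/measurable_EFinP; apply: measurable_funM.
- by move=> x; rewrite lee_fin mulr_ge0// indicE.
Qed.

(** The positive and the negative part each integrate to a number between 0 and the measure of A,
    and two such numbers differ by at most that measure. *)
Lemma Rn_int_real_bound n (A : set 'rV[R]_n) (h : 'rV[R]_n -> R) :
  (Rn_meas A < +oo)%E -> (forall x, `|h x| <= \1_A x) ->
  `|Rn_int_real h| <= fine (Rn_meas A).
Proof.
move=> Afin hA; rewrite /Rn_int_real.
have pos k : (forall x, `|k x| <= \1_A x) ->
    exists2 r, Rn_int (fun x => (Num.max (k x) 0)%:E) = r%:E & 0 <= r <= fine (Rn_meas A).
  move=> kA.
  have k0 x : (0 <= (Num.max (k x) 0)%:E)%E by rewrite lee_fin le_max lexx orbT.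
  have kle : (Rn_int (fun x => (Num.max (k x) 0)%:E) <= Rn_meas A)%E.
    apply: Rn_int_mono => // x; rewrite lee_fin ge_max (le_trans (ler_norm _) (kA x))/=.
    exact: le_trans (kA x).
  have kfin : Rn_int (fun x => (Num.max (k x) 0)%:E) \is a fin_num.
    by rewrite ge0_fin_numE ?(le_lt_trans kle)//; exact: Rn_int_ge0.
  exists (fine (Rn_int (fun x => (Num.max (k x) 0)%:E))); first by rewrite fineK.
  rewrite fine_ge0 ?Rn_int_ge0//= fine_le// ge0_fin_numE//.
  by apply: Rn_int_ge0 => x; rewrite lee_fin indicE.
have [r1 -> r1P] := pos h hA.
have [|r2 -> r2P] := pos (fun x => - h x); first by move=> x; rewrite normrN.
by rewrite /= ler_norml; lra.
Qed.

End OpenSets.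

(** * The weight *)

Section Weight.
Context {R : realType} (k : nat) (hn : (0 < k.+1)%N).
Context (G : set 'rV[R]_k.+1) (b : nat -> R).
Context (GU : G `<=` @unit_cube R k.+1) (Gc : compact G) (Gi : interior G = set0).
Context (b01 : forall m, 0 < b m < 1).

Local Notation w := (wGb hn G b).
Local Notation Gm := (Gshift hn G).

Lemma Ordinal_head : Ordinal hn = ord0.
Proof. exact: val_inj. Qed.

Lemma e1_coord (j : 'I_k.+1) : (e1 R hn) 0 j = (j == ord0)%:R.
Proof. by rewrite /e1 /unitv mxE eqxx Ordinal_head. Qed.

Lemma shift_coord (y : 'rV[R]_k.+1) (c : R) j :
  (y - c *: e1 R hn) 0 j = y 0 j - c * (j == ord0)%:R.
Proof. by rewrite mxE [X in _ + X]mxE [X in - X]mxE e1_coord. Qed.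

Lemma Gshift_head m y : Gm m y -> (2 * m)%:R <= y 0 ord0 <= (2 * m)%:R + 1.
Proof.
move=> /GU /(_ ord0); rewrite !shift_coord eqxx mulr1.
by rewrite subr_ge0 lerBlDl.
Qed.

Lemma Gshift_tail m y i : Gm m y -> i != ord0 -> 0 <= y 0 i <= 1.
Proof.
by move=> /GU /(_ i) + i0; rewrite !shift_coord (negbTE i0) mulr0 subr0.
Qed.

Lemma Gshift_ge0 m y : Gm m y -> 0 <= y 0 ord0.
Proof. by move=> /Gshift_head /andP[+ _]; exact: le_trans. Qed.

Lemma Gshift_inj m p y : Gm m y -> Gm p y -> m = p.
Proof.
move=> /Gshift_head /andP[m1 m2] /Gshift_head /andP[p1 p2].
have := le_trans m1 p2; have := le_trans p1 m2.
by rewrite !natr1 !ler_nat; lia.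
Qed.

(** The index picked by [cid] is the right one because the translates lie in the disjoint slabs 2m
    <= y_1 <= 2m + 1. *)
Lemma wGb_pos_Gshift m y : Gm m y -> wGb_pos hn G b y = b m.
Proof.
move=> my; rewrite /wGb_pos; case: pselect => [h|]; last by case; exists m.
by case: (cid h) => p hp /=; congr b; exact: Gshift_inj hp my.
Qed.

Lemma wGb_pos_out y : (forall m, ~ Gm m y) -> wGb_pos hn G b y = 1.
Proof. by move=> h; rewrite /wGb_pos; case: pselect => // h'; have [m /h] := h'. Qed.

Lemma wGb_Gshift m y : Gm m y -> w y = b m.
Proof.
by move=> my; rewrite /wGb Ordinal_head (Gshift_ge0 my); exact: wGb_pos_Gshift.
Qed.

Lemma wGb_out y : (forall m, ~ Gm m y) -> (forall m, ~ Gm m (- y)) -> w y = 1.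
Proof. by move=> h1 h2; rewrite /wGb; case: ifP => _; exact: wGb_pos_out. Qed.

Lemma wGb_range y : 0 < w y <= 1.
Proof.
have pos z : 0 < wGb_pos hn G b z <= 1.
  rewrite /wGb_pos; case: pselect => [h|_]; last by rewrite ltr01 lexx.
  by have /andP[-> /ltW ->] := b01 (proj1_sig (cid h)).
by rewrite /wGb; case: ifP.
Qed.

(** On the hyperplane y_1 = 0 both y and -y are evaluated by the first branch of [wGb], and the
    values may differ when G_0 touches it. *)
Lemma wGbN (y : 'rV[R]_k.+1) : y 0 ord0 != 0 -> w (- y) = w y.
Proof.
move=> y0; rewrite /wGb Ordinal_head mxE oppr_ge0 opprK.
by case: (ltgtP 0 (y 0 ord0)) y0.
Qed.

Lemma wGb_gap m (y : 'rV[R]_k.+1) : (2 * m)%:R + 1 < y 0 ord0 < (2 * m)%:R + 2 -> w y = 1.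
Proof.
have e : (2 * m)%:R + 2 = (2 * m).+2%:R :> R by rewrite -natrD addn2.
rewrite e natr1 => /andP[y1 y2]; apply: wGb_out => p.
  move=> /Gshift_head /andP[p1]; rewrite natr1 => p2.
  have := lt_le_trans y1 p2; have := le_lt_trans p1 y2.
  by rewrite !ltr_nat; lia.
move=> /Gshift_ge0; rewrite mxE oppr_ge0 leNgt => /negP; apply.
exact: le_lt_trans y1.
Qed.

Lemma Rn_meas_Gshift m : Rn_meas (Gm m) = Rn_meas G.
Proof.
rewrite /Rn_meas -[RHS](Rn_int_translate_head (- (2 * m)%:R)); last first.
  by move=> x; rewrite lee_fin indicE.
apply: eq_Rn_int => x; congr EFin; rewrite !indicE; congr (_ %:R); congr nat_of_bool.
rewrite /Gshift /e1 /unitv Ordinal_head; apply/idP/idP => /set_mem xG; apply/mem_set.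
  by move: xG; rewrite /= scaleNr.
by move: xG; rewrite /= scaleNr.
Qed.

Lemma Gshift_closed m : closed (Gm m).
Proof.
apply: (@closed_comp _ _ (fun y : 'rV[R]_k.+1 => y - (2 * m)%:R *: e1 R hn) G).
  move=> y _.
  exact: (@continuousB _ _ _ id (cst _) y (@cvg_id _ _) (@cst_continuous _ _ _ _)).
by apply: compact_closed Gc; exact: norm_hausdorff.
Qed.

Lemma borel_Gshift m : borel_set (Gm m).
Proof.
have := @sub_sigma_algebra _ setT (@open 'rV[R]_k.+1) _ (closed_openC (@Gshift_closed m)).
move=> /(@measurableC _ (Rn R k.+1)); rewrite setCK.
exact.
Qed.

Lemma open_sub_Gshift m (U : set 'rV[R]_k.+1) : open U -> U `<=` Gm m -> U = set0.
Proof.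
move=> oU UG; apply/seteqP; split=> // y Uy.
suff : interior G (y - (2 * m)%:R *: e1 R hn) by rewrite Gi.
pose V := (fun z : 'rV[R]_k.+1 => z + (2 * m)%:R *: e1 R hn) @^-1` U.
have oV : open V.
  apply: open_comp => // z _.
  exact: (@continuousD _ _ _ id (cst _) z (@cvg_id _ _) (@cst_continuous _ _ _ _)).
have VG : V `<=` G by move=> z /UG; rewrite /Gshift /= addrK.
by move: VG; rewrite open_subsetE//; apply; rewrite /V /= subrK.
Qed.

Lemma open_setD_nonempty (F U : set 'rV[R]_k.+1) : closed F ->
  (forall W, open W -> W `<=` F -> W = set0) -> open U -> U !=set0 ->
  open (U `\` F) /\ (U `\` F) !=set0.
Proof.
move=> cF F0 oU [x Ux]; split; first by apply: openI => //; exact: closed_openC.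
apply: contrapT => h; suff U0 : U = set0 by move: Ux; rewrite U0.
apply: F0 => // y Uy; apply: contrapT => Fy; apply: h; by exists y.
Qed.

(** Removing a closed set with empty interior from a nonempty open set leaves a nonempty open set;
    this is repeated for G_m and -G_m, one index at a time. *)
Lemma open_avoid_lt N (U : set 'rV[R]_k.+1) : open U -> U !=set0 ->
  exists V, [/\ open V, V !=set0, V `<=` U &
    forall m y, (m < N)%N -> V y -> ~ Gm m y /\ ~ Gm m (- y)].
Proof.
elim: N => [|N IH] oU U0; first by exists U; split.
have [V [oV V0 VU hV]] := IH oU U0.
have [oV1 V10] := open_setD_nonempty (@Gshift_closed N) (@open_sub_Gshift N) oV V0.
have oN (W : set 'rV[R]_k.+1) : open W -> open (-%R @^-1` W).
  by move=> oW; apply: open_comp => // y _; exact: opp_continuous.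
have cF : closed (-%R @^-1` (Gm N)).
  by apply: closed_comp => [y _|]; [exact: opp_continuous|exact: Gshift_closed].
have F0 W : open W -> W `<=` -%R @^-1` (Gm N) -> W = set0.
  move=> oW WF; have := @open_sub_Gshift N _ (oN _ oW) => h.
  have {}h : -%R @^-1` W = set0.
    by apply: h => y /WF /=; rewrite opprK.
  apply/seteqP; split=> // y Wy.
  have Wy' : (-%R @^-1` W) (- y) by rewrite /= opprK.
  by rewrite h in Wy'.
have [oV2 V20] := open_setD_nonempty cF F0 oV1 V10.
exists ((V `\` Gm N) `\` (-%R @^-1` (Gm N))); split=> //.
  by move=> y [[/VU]].
move=> m y; rewrite ltnS leq_eqVlt => /predU1P[->|mN] [[Vy h1] h2] //.
exact: hV.
Qed.

Lemma open_avoid (U : set 'rV[R]_k.+1) : open U -> U !=set0 ->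
  exists V, [/\ open V, V !=set0, V `<=` U & forall y, V y -> w y = 1].
Proof.
move=> oU [x Ux].
(* Within distance 1 of x the first coordinate stays below N in absolute value, while G_m with m >=
   N requires it to be at least 2m >= N; so only the indices below N remain to be removed. *)
pose N := Num.bound (`|x 0 ord0| + 1).
have hN : `|x 0 ord0| + 1 < N%:R by apply: archi_boundP; rewrite addr_ge0.
have oB : open (U `&` ball x 1) by apply: openI => //; exact: ball_open.
have B0 : (U `&` ball x 1) !=set0 by exists x; split=> //; exact: ballxx.
have [V [oV V0 VU hV]] := @open_avoid_lt N _ oB B0.
exists V; split=> // [y /VU[]//|y Vy].
have [_ /ball_rVP[_ /(_ ord0) xy]] := VU _ Vy.
have yN : `|y 0 ord0| < N%:R.
  rewrite (le_lt_trans _ hN)// -[X in `|X|](subrK (x 0 ord0)) addrC.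
  by rewrite (le_trans (ler_normD _ _))// lerD2l distrC ltW.
have big m (z : 'rV[R]_k.+1) : `|z 0 ord0| < N%:R -> (N <= m)%N -> ~ Gm m z.
  move=> zN Nm /Gshift_head /andP[+ _]; apply/negP; rewrite -ltNge.
  rewrite (le_lt_trans (ler_norm _))// (lt_le_trans zN)// ler_nat; lia.
apply: wGb_out => m; have [/hV/(_ Vy)[]//|Nm] := ltnP m N; first exact: big.
by apply: big => //; rewrite mxE normrN.
Qed.

(** If an essential bound M were below |u(x)|, the open set where |u| > M would contain a nonempty
    open V on which w = 1, and V would have to be null. *)
Lemma cabs_le_Linfw (u : 'rV[R]_k.+1 -> R[i]) : continuous (fun x => cabs (u x)) ->
  forall x, ((cabs (u x))%:E <= Linfw_norm w u)%E.
Proof.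
move=> uc x; apply: le_ereal_inf_tmp => M [N [mN NM N0]].
rewrite leNgt; apply/negP => Mx.
pose U := [set z | (M < (cabs (u z))%:E)%E].
have oU : open U.
  rewrite /U; case: M {NM Mx U} => [r| |].
  - rewrite (_ : mkset _ = (fun z => cabs (u z)) @^-1` [set t | r < t]).
      by apply: open_comp => // y _; exact: uc.
    by apply/seteqP; split=> z; rewrite /= lte_fin.
  - rewrite (_ : mkset _ = set0); first exact: open0.
    by apply/seteqP; split=> z //=; rewrite ltNge leey.
  - rewrite (_ : mkset _ = setT); first exact: openT.
    by apply/seteqP; split=> z //= _; rewrite ltNyr.
have [V [oV V0 VU w1]] := open_avoid oU (ex_intro _ x Mx).
apply: (Rn_null_open oV V0); exists N; split=> // y Vy.
by apply: NM; rewrite /= w1// mulr1; exact: VU.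
Qed.

Lemma Linfw_le (u : 'rV[R]_k.+1 -> R[i]) M : (forall x, cabs (u x) <= M) ->
  (Linfw_norm w u <= M%:E)%E.
Proof.
move=> uM; apply: ereal_inf_lbound; exists set0; split.
- exact: sigma_algebra0.
- move=> x /=; rewrite lte_fin ltNge => /negP; apply.
  have /andP[w0 w1] := wGb_range x.
  by rewrite (le_trans _ (uM x))// ler_piMr// cabs_ge0.
- rewrite /Rn_meas (_ : Rn_int _ = Rn_int (fun _ : 'rV[R]_k.+1 => 0%E)).
    by rewrite Rn_intE// integral0.
  by apply: eq_Rn_int => x; rewrite indic0.
Qed.

(** * Reflection invariance and failure of the norm fundamental property *)

(** The reflection preserves the integral, and the weight is even off the null hyperplane y_1 =
    0. *)
Lemma reflection_invariant_wGb : L1w_reflection_invariant (fun y => (w y)^-1).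
Proof.
move=> f _; rewrite /L1w_norm.
have wi0 x : 0 <= (w x)^-1 by rewrite invr_ge0 ltW//; case/andP: (wGb_range x).
have c0 (z : R[i]) x : (0 <= (cabs z * (w x)^-1)%:E)%E.
  by rewrite lee_fin mulr_ge0// cabs_ge0.
rewrite -[LHS]Rn_int_reflect//.
apply: Rn_int_eq_head => // x x0; by rewrite wGbN.
Qed.

Lemma Rn_measG_fin : (Rn_meas G < +oo)%E.
Proof. exact: Rn_meas_unit_cube GU. Qed.

Lemma not_norm_fundamental_wGb : (0 < Rn_meas G)%E -> b @ \oo --> 0 ->
  ~ L1w_norm_fundamental (fun y => (w y)^-1).
Proof.
move=> G0 b0 nfp.
(* The indicator of G_m has norm |G| / b_m, whereas pairings with admissible test functions are at
   most 2 |G|, one |G| each for the real and the imaginary part. Hence b_m < 1/2. *)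
have [m bm] : exists m, b m < 1 / 2.
  have : \forall m \near \oo, b m < 1 / 2 by apply: (cvgr_lt _ b0); lra.
  by move=> [m _ /(_ m (leqnn m))]; exists m.
have /andP[bm0 _] := b01 m.
have Gfin := Rn_measG_fin.
pose g := fine (Rn_meas G).
have gE : Rn_meas G = g%:E by rewrite /g fineK// ge0_fin_numE// ltW.
have g0 : 0 < g by rewrite -lte_fin -gE.
pose f (x : 'rV[R]_k.+1) : R[i] := Complex (\1_(Gm m) x) 0.
have normf : L1w_norm (fun y => (w y)^-1) f = ((b m)^-1 * g)%:E.
  rewrite EFinM -gE -(Rn_meas_Gshift m) -Rn_int_scale_indic; last 2 first.
  - exact: borel_Gshift.
  - by rewrite invr_ge0 ltW.
  apply: eq_Rn_int => x; congr EFin; rewrite cabs_real mulrC indicE.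
  case: (boolP (x \in Gm m)) => [/set_mem xG|_]; first by rewrite (wGb_Gshift xG) normr1.
  by rewrite normr0 !mulr0.
have fL : in_L1w (fun y => (w y)^-1) f.
  split; last by rewrite normf ltry.
  split=> B mB.
    have mI : measurable_fun [set: Rn R k.+1] (\1_(Gm m) : Rn R k.+1 -> R).
      by apply: measurable_indic; exact: borel_Gshift.
    by have := mI measurableT _ mB; rewrite setTI.
  have mc : measurable_fun [set: Rn R k.+1] (cst 0 : Rn R k.+1 -> R) by [].
  by have := mc measurableT _ mB; rewrite setTI.
have := nfp f fL; rewrite normf => /esym/eqP; rewrite eq_le => /andP[_]; apply/negP.
rewrite -ltNge; apply: (@le_lt_trans _ _ (2 * g)%:E); last first.
  by rewrite lte_fin ltr_pM2r// -[ltRHS]mul1r ltr_pdivlMr//; lra.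
apply: ge_ereal_sup => _ [psi [[psis _] psi1] <-].
have psi_le1 x : cabs (psi x) <= 1.
  rewrite -lee_fin; apply: le_trans psi1.
  rewrite (_ : (fun y => _) = w); last by apply/funext => y; rewrite invrK.
  exact: cabs_le_Linfw (smooth_cabs_continuous psis) x.
rewrite lee_fin (le_trans (cabs_le_ReIm _))// mulrDl mul1r /g -(Rn_meas_Gshift m).
apply: lerD; apply: Rn_int_real_bound; rewrite ?Rn_meas_Gshift// => x.
  rewrite Re_complexM /= mul0r subr0 normrM ger0_norm; last by rewrite indicE.
  by rewrite ler_piMr ?indicE// (le_trans (cabs_ge_Re _))// psi_le1.
rewrite Im_complexM /= mul0r addr0 normrM ger0_norm; last by rewrite indicE.
by rewrite ler_piMr ?indicE// (le_trans (cabs_ge_Im _))// psi_le1.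
Qed.

(** * The symbol as a multiplier on the two weighted spaces *)

(** A Schwartz u is continuous, so its weighted norm r bounds |u| everywhere; convolution then
    yields a sup bound, which dominates the weighted norm because w <= 1. *)
Lemma multiplier_Linfw : is_multiplier (Linfw_norm w) (in_Linfw w) (@csymbol R k.+1).
Proof.
have [C C0 hC] := @convolution_bound R k.+1.
pose c : R := (2 * pi) ^- k.+1.
have c0 : 0 <= c by rewrite invr_ge0 exprn_ge0// mulr_ge0// pi_ge0.
apply: (@le_lt_trans _ _ (2 * c * C)%:E); last exact: ltry.
apply: ge_ereal_sup => _ [u [[u1 u2] [_ ufin] _] <-].
have us : smooth u by split; [case: u1|case: u2].
have hN := cabs_le_Linfw (smooth_cabs_continuous us).
have N0 : (0 <= Linfw_norm w u)%E.
  by apply: le_trans (hN 0); rewrite lee_fin cabs_ge0.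
have : Linfw_norm w u \is a fin_num by rewrite ge0_fin_numE.
move: N0 hN; case: (Linfw_norm w u) => [r| |]//; rewrite lee_fin => r0 hN _ /=.
have ur x : cabs (u x) <= r by rewrite -lee_fin.
have i1 := integrable_schwartz u1; have i2 := integrable_schwartz u2.
have b1 x := hC _ x r i1 r0 (fun z => le_trans (cabs_ge_Re (u z)) (ur z)).
have b2 x := hC _ x r i2 r0 (fun z => le_trans (cabs_ge_Im (u z)) (ur z)).
have : (Linfw_norm w (fmult (@csymbol R k.+1) u) <= (2 * c * C * r)%:E)%E.
  apply: Linfw_le => x; rewrite fmult_convolution//.
  rewrite (le_trans (cabs_le_ReIm _))//= !normrM (ger0_norm c0).
  have := ler_wpM2l c0 (b1 x); have := ler_wpM2l c0 (b2 x); lra.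
move=> /(lee_wpmul2r (_ : 0 <= (r^-1)%:E)%E) h.
apply: (le_trans (h _)); first by rewrite lee_fin invr_ge0.
rewrite -EFinM lee_fin; have [->|r_neq0] := eqVneq r 0.
  by rewrite mulr0 mul0r !mulr_ge0.
by rewrite mulfK.
Qed.

(** Centred at 2m + 3/2 in the first coordinate and at 1/2 in the others, with half-width 1/2: it
    lives on the unit cube between G_m and G_(m+1), where w = 1. *)
Definition gap_bump m : 'rV[R]_k.+1 -> R :=
  tensor (fun i t => sbump (2 * t + (if i == ord0 then - (4 * m + 3)%:R else - 1))).

Lemma gap_bump_ge0 m z : 0 <= gap_bump m z.
Proof. by apply: prodr_ge0 => i _; exact: sbump_ge0. Qed.

Lemma gap_bump_supp m z : gap_bump m z != 0 ->
  (2 * m)%:R + 1 < z 0 ord0 < (2 * m)%:R + 2 /\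
  forall i, i != ord0 -> 0 < z 0 i < 1.
Proof.
move=> /prodf_neq0 h.
have hi i : `|2 * z 0 i + (if i == ord0 then - (4 * m + 3)%:R else - 1)| < 1.
  by rewrite ltNge; apply/negP => /sbump_eq0 /eqP; apply/negP; exact: h.
split=> [|i i0].
  have := hi ord0; rewrite eqxx ltr_norml natrD !natrM; lra.
by have := hi i; rewrite (negbTE i0) ltr_norml; lra.
Qed.

Lemma schwartz_gap_bump m : schwartz_real (gap_bump m).
Proof.
apply: (@schwartz_real_tensor _ _ _ ((2 * m)%:R + 2)) => [j i|i t tM].
  by apply: Ck1_affine; exact: Ck1_sbump.
apply: sbump_eq0; have m0 : 0 <= m%:R :> R by [].
move: tM; rewrite natrM => tM.
have [t0|t0] := ger0P t; [rewrite ger0_norm// in tM|rewrite ltr0_norm// in tM];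
  rewrite ler_normr; case: ifP => _; rewrite ?natrD ?natrM; apply/orP; [left|left|right|right]; lra.
Qed.

Lemma gap_bump_center_gt0 m : exists x, 0 < gap_bump m x.
Proof.
exists (\row_i (if i == ord0 then (4 * m + 3)%:R / 2 else 1 / 2)).
apply: prodr_gt0 => i _; apply: sbump_gt0; rewrite mxE; case: ifP => _.
  by rewrite mulrCA mulfV// mulr1 subrr normr0.
by rewrite mulrCA mulfV// mulr1 subrr normr0.
Qed.

Lemma not_multiplier_L1w : (0 < Rn_meas G)%E -> b @ \oo --> 0 ->
  ~ is_multiplier (L1w_norm (fun y => (w y)^-1)) (in_L1w (fun y => (w y)^-1))
      (@csymbol R k.+1).
Proof.
move=> G0 b0; rewrite /is_multiplier; set S := ereal_sup _ => Sfin.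
have Gfin := Rn_measG_fin.
pose g := fine (Rn_meas G).
have gE : Rn_meas G = g%:E by rewrite /g fineK// ge0_fin_numE// ltW.
have g0 : 0 < g by rewrite -lte_fin -gE.
have [c c0 hc] := @convolution_lower R k.+1.
pose d : R := (2 * pi) ^- k.+1.
have d0 : 0 < d by rewrite invr_gt0 exprn_gt0// mulr_gt0// pi_gt0.
(* The quotient for the bump of the m-th gap: its norm U is unweighted, and on G_m its image is at
   least d c U, which the weight divides by b_m. *)
have key m : ((d * c * g / b m)%:E <= S)%E.
  have /andP[bm0 _] := b01 m.
  pose u (x : 'rV[R]_k.+1) : R[i] := Complex (gap_bump m x) 0.
  have us : schwartz u by split; [exact: schwartz_gap_bump|exact: schwartz_real0].
  have ui := integrable_schwartz (schwartz_gap_bump m).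
  have i2 := integrable_schwartz (@schwartz_real0 R k.+1).
  have uc : continuous (gap_bump m) by have [/(_ 0) []] := schwartz_gap_bump m.
  pose U := \int[lebn k.+1]_z gap_bump m z.
  have [x0 ux0] := gap_bump_center_gt0 m.
  have U0 : 0 < U := Rintegral_continuous_gt0 uc (@gap_bump_ge0 m) ui ux0.
  have normu : L1w_norm (fun y => (w y)^-1) u = U%:E.
    rewrite -(EFin_Rintegral ui) -Rn_intE; last 2 first.
    - exact: measurable_int ui.
    - by move=> x; rewrite lee_fin gap_bump_ge0.
    apply: eq_Rn_int => x; rewrite cabs_real ger0_norm ?gap_bump_ge0//; congr EFin.
    have [->|/gap_bump_supp [hx _]] := eqVneq (gap_bump m x) 0; first by rewrite mul0r.
    by rewrite (wGb_gap hx) invr1 mulr1.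
  apply: le_trans; last first.
    apply: ereal_sup_ubound; exists u; last by [].
    split=> //; last first.
      by move=> /(congr1 (fun v => complex.Re (v x0))) /= h; move: ux0; rewrite h ltxx.
    split; last by rewrite normu ltry.
    split=> B mB.
      by have := (continuous_Rn_measurable uc) measurableT _ mB; rewrite setTI.
    have mc : measurable_fun [set: Rn R k.+1] (cst 0 : Rn R k.+1 -> R) by [].
    by have := mc measurableT _ mB; rewrite setTI.
  rewrite normu /=.
  have low : ((d * (c * U) / b m * g)%:E <=
      L1w_norm (fun y => (w y)^-1)%R (fmult (@csymbol R k.+1) u))%E.
    have s0 : 0 <= d * (c * U) / b m.
      by rewrite divr_ge0 ?mulr_ge0// ltW.
    rewrite EFinM -gE -(Rn_meas_Gshift m) -Rn_int_scale_indic//; last exact: borel_Gshift.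
    apply: Rn_int_mono => y; rewrite lee_fin; first by rewrite mulr_ge0// indicE.
    have wi0 : 0 <= (w y)^-1 by rewrite invr_ge0 ltW//; case/andP: (wGb_range y).
    rewrite indicE; case: (boolP (y \in Gm m)) => [/set_mem yG|_]; last first.
      by rewrite mulr0 mulr_ge0// cabs_ge0.
    rewrite mulr1 (wGb_Gshift yG) ler_wpM2r ?invr_ge0 ?(ltW bm0)//.
    rewrite fmult_convolution//; apply: le_trans (cabs_ge_Re _) => /=.
    apply: le_trans (ler_norm _); rewrite ler_wpM2l ?(ltW d0)//.
    apply: hc => // [z|z uz i]; first exact: gap_bump_ge0.
    (* The first coordinates lie in the adjacent intervals [2m, 2m + 1] and ]2m + 1, 2m + 2[, the
       others all in [0, 1]; this is the origin of the distance 2. *)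
    have [z1 z2] := gap_bump_supp uz; have y1 := Gshift_head yG.
    have [->|i0] := eqVneq i ord0; first by rewrite ler_norml; lra.
    have := z2 i i0; have := Gshift_tail yG i0; rewrite ler_norml; lra.
  have Ui : (0 <= (U^-1)%:E)%E by rewrite lee_fin invr_ge0 ltW.
  apply: le_trans (lee_wpmul2r Ui low); rewrite -EFinM lee_fin.
  rewrite le_eqVlt; apply/orP; left; apply/eqP; field.
  by rewrite !gt_eqF.
(* The assumption excludes +oo and the lower bound [key 0] excludes -oo. Then d c g <= s b_m for
   every m, against b_m -> 0 and d c g > 0. *)
have Sreal : S \is a fin_num.
  by rewrite fin_numE -ltey Sfin andbT gt_eqF// (lt_le_trans _ (key 0))// ltNyr.
pose s := fine S.
have SE : S = s%:E by rewrite /s fineK.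
have key' m : d * c * g <= s * b m.
  have /andP[bm0 _] := b01 m.
  by have := key m; rewrite SE lee_fin ler_pdivrMr.
have dcg0 : 0 < d * c * g by rewrite !mulr_gt0.
have sb0 : (s * b m) @[m --> \oo] --> s * 0 by apply: cvgM => //; exact: cvg_cst.
have : \forall m \near \oo, s * b m < d * c * g by apply: (cvgr_lt _ sb0); rewrite mulr0.
by move=> [m _ /(_ m (leqnn m))] /=; rewrite ltNge key'.
Qed.

End Weight.

Theorem theorem7p9 (R : realType) (n : nat) (hn : (0 < n)%N)
    (G : set 'rV[R]_n) (b : nat -> R) :
  G `<=` @unit_cube R n ->
  compact G ->
  (0 < Rn_meas G)%E ->
  interior G = set0 ->
  (forall m, 0 < b m < 1) ->
  b @ \oo --> 0 ->
  let w := wGb hn G b in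
  let winv := fun y => (w y)^-1 in
  [/\ L1w_reflection_invariant winv,
      ~ L1w_norm_fundamental winv &
      exists a : 'rV[R]_n -> R[i],
        [/\ schwartz a,
            is_multiplier (Linfw_norm w) (in_Linfw w) a &
            ~ is_multiplier (L1w_norm winv) (in_L1w winv) a]].
Proof.
case: n hn G => // k hn G GU Gc G0 Gi b01 b0 w winv; split.
- exact: reflection_invariant_wGb.
- exact: not_norm_fundamental_wGb.
- exists (@csymbol R k.+1); split.
  + exact: schwartz_csymbol.
  + exact: multiplier_Linfw.
  + exact: not_multiplier_L1w.
Qed.
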